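(* Let $M,K$ be integers with $1\le K\le M-1$, put $T=M-K-1$, and let $W>0$, $R>0$, $P_S>0$, $\alpha>0$, $\sigma^2>0$. Let $\mu$, $\phi=P_S\alpha/\sigma^2$, $\omega=(\phi(1-\mu))^{-1}$, $z=2^R-1$, the random variables $\gamma_0,\gamma_1,\dots,\gamma_M$, the densities $f_{\gamma_0}$ and $f_{\gamma_m|\gamma_0=x_0}$, and the outage probability $P_{\mathrm{out}}$ be as in the context. For $x_0\ge 0$ and $v\ge 0$ set $$\Psi(v,x_0)=\Big(1-Q_1\big(\sqrt{2\omega\mu x_0},\sqrt{2\omega v}\big)\Big)^T,$$ and, for $0\le v\le z/K$, $$\Phi(z,v,x_0)=e^{-\omega(Kv+K\mu x_0)}\sum_{r_1=0}^{\infty}\cdots\sum_{r_K=0}^{\infty}\Big(\prod_{m=1}^K d_{r_m}\Big)x_0^{\eta}\sum_{l_1=0}^{r_1}\cdots\sum_{l_K=0}^{r_K}\Big(\prod_{m=1}^K\frac{1}{l_m!}\Big)v^{\epsilon}\,\frac{\gamma\big(\chi,\omega(z-Kv)\big)}{(\chi-1)!\,\omega^{\chi}},$$ where $d_k=\frac{\omega^{2k+1}\mu^k}{k!}$, $\eta=\sum_{m=1}^K r_m$, $\epsilon=\sum_{m=1}^K l_m$ and $\chi=K+\eta-\epsilon$. Then $$P_{\mathrm{out}}=\int_0^\infty\int_0^{z/K}\binom{M}{K}(T+1)\,\Phi(z,v,x_0)\,\Psi(v,x_0)\,f_{\gamma_m|\gamma_0=x_0}(v)\,f_{\gamma_0}(x_0)\,dv\,dx_0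 .$$
   Context: Setting (fluid antenna system with $M$ ports, of which the best $K$ are activated and combined by maximum ratio combining, in Rayleigh fading). The correlation factor is $$\mu=\sqrt2\,\sqrt{{}_1F_2\big(\tfrac12;1,\tfrac32;-\pi^2W^2\big)-\frac{J_1(2\pi W)}{2\pi W}},$$ with ${}_1F_2$ the generalized hypergeometric function and $J_1$ the Bessel function of the first kind of order 1; it satisfies $0<\mu<1$. The average SNR is $\phi=P_S\alpha/\sigma^2$ ($P_S$ transmit power, $\alpha$ average channel gain, $\sigma^2$ noise power) and $\omega=(\phi(1-\mu))^{-1}$. The random variable $\gamma_0$ (SNR of a virtual reference port) has density $f_{\gamma_0}(x)=\frac1\phi e^{-x/\phi}$, $x\ge0$. Conditionally on $\gamma_0=x_0$, the port SNRs $\gamma_1,\dots,\gamma_M$ are independent and identically distributed with density $$f_{\gamma_m|\gamma_0=x_0}(x)=\omega e^{-\omega(x+\mu x_0)}I_0\big(2\omega\sqrt{\mu x_0x}\big),\qquad x\ge 0,$$ where $I_0(u)=\sum_{k\ge0}\frac{u^{2k}}{2^{2k}(k!)^2}$ is the modified Bessel function of the first kind of order 0. Let $\mathbb K\subset\{1,\dots,M\}$ be the (random) set of indices of the $K$ largest values among $\gamma_1,\dots,\gamma_M$. For the fixed data rate $R$, the outage probability is $P_{\mathrm{out}}=\Pr\big(\log_2(1+\sum_{m\in\mathbb K}\gamma_m)\le R\big)$, i.e. $P_{\mathrm{out}}=\Pr(\sum_{m\in\mathbb K}\gamma_m\le z)$ with $z=2^R-1$. $Q_1(a,b)=\int_b^\infty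 t\,e^{-(t^2+a^2)/2}I_0(at)\,dt$ is the first-order Marcum $Q$-function, and $\gamma(\kappa,x)=\int_0^xe^{-t}t^{\kappa-1}dt$ (with two arguments) is the lower incomplete Gamma function. *)

(* Defs.v *)
From HB Require Import structures.
From mathcomp Require Import all_boot all_order all_algebra.
From mathcomp Require Import all_classical all_reals all_analysis.

Set Implicit Arguments.
Unset Strict Implicit.
Unset Printing Implicit Defensive.

Import Order.TTheory GRing.Theory Num.Theory.
Import numFieldNormedType.Exports.

Local Open Scope classical_set_scope.
Local Open Scope ring_scope.

Section special_functions.
Context {R : realType}.
Implicit Types (a b c u x kappa : R) (n k : nat).

Definition log2 x : R := ln x / ln 2.

Definition pochhammer a k : R := \prod_(i < k) (a + i%:R).

Definition hypergeom_1F2 a b c x : R :=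
  limn (series (fun k =>
    pochhammer a k / (pochhammer b k * pochhammer c k) * (x ^+ k / k`!%:R))).

Definition bessel_J n u : R :=
  limn (series (fun k =>
    (-1) ^+ k / (k`!%:R * (k + n)`!%:R) * (u / 2) ^+ (2 * k + n))).

Definition bessel_I0 u : R :=
  limn (series (fun k => u ^+ (2 * k) / (2 ^+ (2 * k) * k`!%:R ^+ 2))).

Definition marcum_Q1 a b : R :=
  \int[lebesgue_measure]_(t in `[b, +oo[)
    (t * expR (- (t ^+ 2 + a ^+ 2) / 2) * bessel_I0 (a * t)).

Definition lower_gamma kappa x : R :=
  \int[lebesgue_measure]_(t in `[0, x]) (expR (- t) * t `^ (kappa - 1)).

End special_functions.

Section iterated_sums.
Context {R : realType}.

(* [iter_series K F] is the K-fold iterated series, over r_1, ..., r_K : nat,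
   of F [:: r_1; ...; r_K]. *)
Fixpoint iter_series (K : nat) (F : seq nat -> \bar R) : \bar R :=
  if K is K'.+1 then
    (\sum_(0 <= r <oo) iter_series K' (fun s => F (r :: s)))%E
  else F [::].

(* [iter_sum [:: r_1; ...; r_K] F] is the iterated finite sum, over
   0 <= l_1 <= r_1, ..., 0 <= l_K <= r_K, of F [:: l_1; ...; l_K]. *)
Fixpoint iter_sum (rs : seq nat) (F : seq nat -> R) : R :=
  if rs is r :: rs' then
    \sum_(0 <= l < r.+1) iter_sum rs' (fun s => F (l :: s))
  else F [::].

End iterated_sums.

Section laws.
Context {d : measure_display} {Omega : measurableType d} {R : realType}.
Variable P : probability Omega R.

Definition has_density (X : {RV P >-> R}) (f : R -> R) : Prop :=
  forall A : set R, measurable A ->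
    distribution P X A = (\int[lebesgue_measure]_(x in A) (f x)%:E)%E.

(* Conditionally on X0 = x0, the X m are i.i.d. with density f x0: the product
   of the laws with density f x0 is a regular conditional distribution of the
   family X given X0 (it is enough to test it on measurable boxes). *)
Definition cond_iid_density (X0 : {RV P >-> R}) (M : nat)
    (X : 'I_M -> {RV P >-> R}) (f : R -> R -> R) : Prop :=
  forall (A0 : set R) (A : 'I_M -> set R),
    measurable A0 -> (forall m, measurable (A m)) ->
    P [set w | A0 (X0 w) /\ forall m, A m (X m w)] =
    (\int[distribution P X0]_(x0 in A0)
       \prod_(m < M) \int[lebesgue_measure]_(x in A m) (f x0 x)%:E)%E.

End laws.

(* A is a set of indices of the K largest values of x. Ties may be broken
   arbitrarily; the sum of x over A does not depend on how. *)
Definition top_indices {R : realType} (M K : nat) (x : 'I_M -> R)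
    (A : {set 'I_M}) : Prop :=
  #|A| = K /\ forall i j, i \in A -> j \notin A -> x j <= x i.

Section fluid_antenna.
Context {R : realType}.
Implicit Types (W phi omega mu z v x : R) (K T : nat).

Definition correlation_factor W : R :=
  Num.sqrt 2 * Num.sqrt
    (hypergeom_1F2 (1 / 2) 1 (3 / 2) (- (pi ^+ 2 * W ^+ 2))
     - bessel_J 1 (2 * pi * W) / (2 * pi * W)).

(* The densities are those of nonnegative variables, extended by 0. *)
Definition ref_density phi : R -> R :=
  (fun x => 1 / phi * expR (- x / phi)) \_ `[0, +oo[.

Definition port_density omega mu x0 : R -> R :=
  (fun x => omega * expR (- omega * (x + mu * x0))
            * bessel_I0 (2 * omega * Num.sqrt (mu * x0 * x))) \_ `[0, +oo[.

Definition Psi omega mu T v x0 : R :=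
  (1 - marcum_Q1 (Num.sqrt (2 * omega * mu * x0)) (Num.sqrt (2 * omega * v)))
    ^+ T.

Definition dcoef omega mu (k : nat) : R :=
  omega ^+ (2 * k + 1) * mu ^+ k / k`!%:R.

Definition Phi omega mu K z v x0 : \bar R :=
  ((expR (- omega * (K%:R * v + K%:R * mu * x0)))%:E *
   iter_series K (fun r =>
     ((\prod_(k <- r) dcoef omega mu k) * x0 ^+ sumn r *
      iter_sum r (fun l =>
        let chi := (K + sumn r - sumn l)%N in
        (\prod_(k <- l) (k`!%:R)^-1) * v ^+ sumn l *
        (lower_gamma chi%:R (omega * (z - K%:R * v))
         / ((chi - 1)`!%:R * omega ^+ chi))))%:E))%E.

End fluid_antenna.

(* Main.v *)
Require Import Defs.
From HB Require Import structures.
From mathcomp Require Import all_boot all_order all_algebra.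
From mathcomp Require Import all_classical all_reals all_analysis.
From mathcomp Require Import measurable_realfun.
From mathcomp Require Import zify ring lra.

Import Order.TTheory GRing.Theory Num.Theory.
Import numFieldNormedType.Exports.

Local Open Scope classical_set_scope.
Local Open Scope ring_scope.

(** Conditionally on [gamma0 = x0] the port densities factor, so the law of
    [gamma0] followed by the ports in any order is an iterated Lebesgue integral
    of a product density; this is checked on boxes only. The outage event is
    squeezed between a disjoint union (strict inequalities) and a union (weak
    inequalities) of events "the ports of A are above port j, all others are
    below it, and the ports of A sum to at most z", over the pairs (A, j) with
    [#|A| = K] and [j] outside [A]. All these events have the same probability,
    whether the inequalities are strict or weak, and there are
    ['C(M, K) * (M - K)] of them.

    Given the value [v] of port j, the lower ports contribute a power of the
    cumulative distribution function, equal to [1 - Q_1] because both sides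
    expand as the same Poisson mixture of Erlang tails. For the upper ports,
    each density is a series of terms [x ^ r * exp (- omega x)]; expanding
    [x ^ r] around [v] by the binomial formula reduces the constraint
    [sum <= z] to convolutions of Erlang laws, which yields [Phi].

    The correlation factor [mu] is nonnegative as a product of square roots, and
    [mu < 1] because otherwise the conditional "densities" would have total mass
    [0] or [-oo], contradicting the law of the ports. *)

(** * Iterated Lebesgue integrals over sequences *)

Section iterated_integral.
Context {R : realType}.
Local Notation leb := (@lebesgue_measure R).
Local Open Scope ereal_scope.

(** Integrands take plain sequences rather than tuples, so that consing and concatenating variables
    needs no cast; only sequences of length [n] matter. *)
Fixpoint iter_integral (n : nat) (g : seq R -> \bar R) : \bar R :=
  if n is n'.+1 then \int[leb]_x iter_integral n' (fun s => g (x :: s))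
  else g [::].

(** The parameter in [T] carries the induction: the inner integrals depend on the head variable,
    which joins the parameter space as [T * R]. *)
Definition tuple_measurable d (T : measurableType d) n
    (g : T -> seq R -> \bar R) :=
  measurable_fun setT (fun p : T * n.-tuple R => g p.1 (tval p.2)).

Lemma tuple_measurable_cons d (T : measurableType d) n g :
  tuple_measurable d T n.+1 g ->
  tuple_measurable _ (T * R)%type n (fun p s => g p.1 (p.2 :: s)).
Proof.
move=> mg.
pose c (p : (T * R) * n.-tuple R) : T * n.+1.-tuple R :=
  (p.1.1, [the n.+1.-tuple R of p.1.2 :: p.2]).
have mc : measurable_fun setT c.
  apply/measurable_fun_pairP; split => /=.
    exact: (measurableT_comp measurable_fst measurable_fst).
  apply: measurable_cons; last exact: measurable_snd.
  exact: (measurableT_comp measurable_snd measurable_fst).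
exact: (measurableT_comp mg mc).
Qed.

Lemma iter_integral_ge0 n g : (forall s, 0 <= g s) -> 0 <= iter_integral n g.
Proof.
elim: n g => [|n IH] g g0 //=; apply: integral_ge0 => x _; exact: IH.
Qed.

Lemma eq_iter_integral n g h : (forall s, size s = n -> g s = h s) ->
  iter_integral n g = iter_integral n h.
Proof.
elim: n g h => [|n IH] g h gh /=; first exact: gh.
by apply: eq_integral => x _; apply: IH => s sn; apply: gh; rewrite /= sn.
Qed.

Lemma measurable_iter_integral d (T : measurableType d) n g :
  (forall t s, 0 <= g t s) ->
  tuple_measurable d T n g ->
  measurable_fun setT (fun t => iter_integral n (g t)).
Proof.
elim: n d T g => [|n IH] d T g g0 mg /=.
  have mc : measurable_fun setT (fun t : T => (t, [tuple] : 0.-tuple R)).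
    apply/measurable_fun_pairP; split => /=; first exact: measurable_id.
    exact: measurable_cst.
  exact: (measurableT_comp mg mc).
pose h (p : T * R) := iter_integral n (fun s => g p.1 (p.2 :: s)).
apply: (@measurable_fun_fubini_tonelli_F _ _ T _ R leb h).
  apply: (IH _ (T * R)%type (fun p s => g p.1 (p.2 :: s))) => //.
  exact: tuple_measurable_cons.
by move=> p; exact: iter_integral_ge0.
Qed.

Definition seq_measurable n (g : seq R -> \bar R) :=
  measurable_fun setT (fun t : n.-tuple R => g (tval t)).

Lemma seq_measurable_cons n g : seq_measurable n.+1 g ->
  tuple_measurable _ R n (fun x s => g (x :: s)).
Proof.
move=> mg.
have mc : measurable_fun setT
    (fun p : R * n.-tuple R => [the n.+1.-tuple R of p.1 :: p.2]).
  by apply: measurable_cons; [exact: measurable_fst|exact: measurable_snd].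
exact: (measurableT_comp mg mc).
Qed.

Lemma seq_measurable_behead n g (x : R) : seq_measurable n.+1 g ->
  seq_measurable n (fun s => g (x :: s)).
Proof.
move=> mg.
have mc : measurable_fun setT
    (fun p : n.-tuple R => [the n.+1.-tuple R of x :: p]).
  by apply: measurable_cons; [exact: measurable_cst|exact: measurable_id].
exact: (measurableT_comp mg mc).
Qed.

Lemma measurable_iter_integral_cons n g : (forall s, 0 <= g s) ->
  seq_measurable n.+1 g ->
  measurable_fun setT (fun x => iter_integral n (fun s => g (x :: s))).
Proof.
move=> g0 mg; apply: (measurable_iter_integral _ R _ (fun x s => g (x :: s))).
  by move=> x s; exact: g0.
exact: seq_measurable_cons.
Qed.

Lemma iter_integral_nneseries n (g : nat -> seq R -> \bar R) :
  (forall k s, 0 <= g k s) -> (forall k, seq_measurable n (g k)) ->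
  iter_integral n (fun s => \sum_(0 <= k <oo) g k s) =
  \sum_(0 <= k <oo) iter_integral n (g k).
Proof.
elim: n g => [|n IH] g g0 mg //=.
transitivity (\int[leb]_x
    \sum_(0 <= k <oo) iter_integral n (fun s => g k (x :: s))).
  apply: eq_integral => x _; apply: IH => [k s|k]; first exact: g0.
  exact: seq_measurable_behead.
rewrite integral_nneseries// => [k|k x _].
  by apply: measurable_iter_integral_cons.
by apply: iter_integral_ge0.
Qed.

Lemma iter_integralZl n (c : \bar R) (g : seq R -> \bar R) : 0 <= c ->
  (forall s, 0 <= g s) -> seq_measurable n g ->
  iter_integral n (fun s => c * g s) = c * iter_integral n g.
Proof.
move=> c0; elim: n g => [|n IH] g g0 mg //=.
rewrite -ge0_integralZl//.
- apply: eq_integral => x _; apply: IH => //; exact: seq_measurable_behead.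
- exact: measurable_iter_integral_cons.
- by move=> x _; exact: iter_integral_ge0.
Qed.

Lemma seq_measurableM n (f g : seq R -> \bar R) :
  seq_measurable n f -> seq_measurable n g ->
  seq_measurable n (fun s => f s * g s).
Proof. by move=> mf mg; apply: emeasurable_funM. Qed.

Lemma measurable_nth n i :
  measurable_fun setT (fun t : n.-tuple R => nth 0%R (tval t) i).
Proof.
have [ni|ni] := leqP n i.
  rewrite (_ : (fun _ => _) = cst 0%R); first exact: measurable_cst.
  by apply/funext => t; rewrite nth_default ?size_tuple.
rewrite (_ : (fun _ => _) = (fun t : n.-tuple R => tnth t (Ordinal ni))).
  exact: measurable_tnth.
by apply/funext => t; rewrite (tnth_nth 0%R).
Qed.

Lemma seq_measurable_prod n m (h : nat -> R -> \bar R) :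
  (forall i, measurable_fun setT (h i)) ->
  seq_measurable n (fun s => \prod_(i < m) h i (nth 0%R s i)).
Proof.
move=> mh; elim: m => [|m IH].
  rewrite /seq_measurable; under eq_fun do rewrite big_ord0.
  exact: measurable_cst.
rewrite /seq_measurable; under eq_fun do rewrite big_ord_recr /=.
apply: emeasurable_funM; first exact: IH.
exact: (measurableT_comp (mh m) (measurable_nth n m)).
Qed.

Lemma iter_integral_prod n (h : nat -> R -> \bar R) :
  (forall i x, 0 <= h i x) -> (forall i, measurable_fun setT (h i)) ->
  iter_integral n (fun s => \prod_(i < n) h i (nth 0%R s i)) =
  \prod_(i < n) \int[leb]_x h i x.
Proof.
elim: n h => [|n IH] h h0 mh; first by rewrite /= !big_ord0.
rewrite big_ord_recl /=.
transitivity (\int[leb]_x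
  (h 0%N x * \prod_(i < n) \int[leb]_x h i.+1 x)).
  apply: eq_integral => x _.
  rewrite -(IH (fun i => h i.+1))// -iter_integralZl//; first last.
  - exact: (seq_measurable_prod n n (fun i => h i.+1)).
  - by move=> s; apply: prode_ge0.
  - by apply: eq_iter_integral => s _; rewrite big_ord_recl.
rewrite ge0_integralZr//; last first.
  by apply: prode_ge0 => i _; apply: integral_ge0 => x _; exact: h0.
exact: mh.
Qed.

Lemma iter_integral_cat m n g :
  iter_integral (m + n) g =
  iter_integral m (fun s => iter_integral n (fun t => g (s ++ t))).
Proof.
elim: m g => [|m IH] g //=.
by apply: eq_integral => x _; rewrite IH.
Qed.

End iterated_integral.

(** * Measures on tuples: uniqueness on boxes and densities *)

Section tuple_laws.
Context {R : realType} (n : nat).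
Local Open Scope ereal_scope.

Definition box (A : 'I_n -> set R) : set (n.-tuple R) :=
  [set t | forall i, A i (tnth t i)].

Lemma measurable_box A : (forall i, measurable (A i)) -> measurable (box A).
Proof.
move=> mA.
rewrite (_ : box A = \bigcap_(i in [set: 'I_n]) ((@tnth _ R)^~ i) @^-1` (A i)).
  apply: fin_bigcap_measurable; first exact: finite_finset.
  move=> i _; rewrite -[X in measurable X]setTI.
  exact: measurable_tnth.
by apply/seteqP; split => t /= h i; [move=> _; exact: h|exact: h].
Qed.

(* The boxes form a generating pi-system. *)
Lemma tuple_measure_unique (m1 m2 : {measure set (n.-tuple R) -> \bar R}) :
  m1 setT < +oo ->
  (forall A, (forall i, measurable (A i)) -> m1 (box A) = m2 (box A)) ->
  forall B, measurable B -> m1 B = m2 B.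
Proof.
move=> m1T m12 B mB.
pose G := [set B | exists2 A, (forall i, measurable (A i)) & B = box A].
apply: (measure_unique G (fun=> setT)) => //.
- apply/seteqP; split.
    apply: smallest_sub; first exact: smallest_sigma_algebra.
    apply: (big_ind (fun S => S `<=` <<s G >>)) => [//|S1 S2 h1 h2|i _].
      by rewrite subUset.
    move=> _ [A mA <-]; apply: sub_sigma_algebra.
    (* A generator of the product sigma-algebra constrains one coordinate; it is the box with the
       whole line in all other coordinates. *)
    exists (fun j => if j == i then A else setT).
      by move=> j; case: ifP.
    apply/seteqP; split => t /=.
      by move=> [_ At] j; case: eqP => [->|].
    by move=> /(_ i); rewrite eqxx; split.
  apply: smallest_sub; first exact: sigma_algebra_measurable.
  by move=> _ [A mA ->]; exact: measurable_box.
- move=> _ _ [A mA ->] [A' mA' ->].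
  exists (fun i => A i `&` A' i); first by move=> i; exact: measurableI.
  apply/seteqP; split => t /=; first by move=> [h h'] i; split.
  by move=> h; split => i; case: (h i).
- move=> _; exists (fun=> setT) => //.
  by apply/seteqP; split.
- by rewrite bigcup_const.
- by move=> _ [A mA ->]; exact: m12.
Qed.

End tuple_laws.

Section density.
Local Open Scope ereal_scope.
Context d (T : measurableType d) {R : realType}.
Variables (m mu : {measure set T -> \bar R}) (f : T -> R).
Hypothesis f_ge0 : forall x, (0 <= f x)%R.
Hypothesis mf : measurable_fun setT f.
Hypothesis mE : forall A, measurable A -> m A = \int[mu]_(x in A) (f x)%:E.

Import HBNNSimple.

Let mfE : measurable_fun setT (EFin \o f).
Proof. exact/measurable_EFinP. Qed.

Let integral_density_nnsfun (h : {nnsfun T >-> R}) :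
  \int[m]_x (h x)%:E = \int[mu]_x ((h x)%:E * (f x)%:E).
Proof.
rewrite integralT_nnsfun sintegralE.
have mh r : measurable (h @^-1` [set r]) by exact: measurable_sfunP.
under [RHS]eq_integral.
  move=> x _; rewrite (fimfunE h x) -fsumEFin//.
  rewrite ge0_mule_fsuml => [|y]; last exact: nnfun_muleindic_ge0.
  over.
have mi r : measurable_fun setT (fun x => (r * \1_(h @^-1` [set r]) x)%:E * (f x)%:E).
  apply: emeasurable_funM => //; apply/measurable_EFinP.
  exact: measurable_funM.
rewrite ge0_integral_fsum//; last first.
  move=> y x _; apply: mule_ge0; last by rewrite lee_fin.
  exact: nnfun_muleindic_ge0.
apply: eq_fsbigr => r; rewrite inE => -[t _ hr].
rewrite mE// -hr.
under [RHS]eq_integral do rewrite EFinM -muleA.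
rewrite ge0_integralZl//=; last 3 first.
  apply: emeasurable_funM => //; exact/measurable_EFinP.
  by move=> x _; rewrite mule_ge0 ?lee_fin ?f_ge0.
  by rewrite lee_fin.
congr *%E; rewrite integral_mkcond; apply: eq_integral => x _.
by rewrite epatch_indic/= muleC.
Qed.

(** The identity holds for simple functions by linearity and passes to their increasing limits;
    restriction to [D] is absorbed into the integrand. *)
Lemma integral_density (g : T -> \bar R) (D : set T) : measurable D ->
  measurable_fun setT g -> (forall x, 0 <= g x) ->
  \int[m]_(x in D) g x = \int[mu]_(x in D) (g x * (f x)%:E).
Proof.
move=> mD mg' g0'.
suff gen (k : T -> \bar R) : measurable_fun setT k -> (forall x, 0 <= k x) ->
    \int[m]_x k x = \int[mu]_x (k x * (f x)%:E).
  rewrite integral_mkcond gen; last 2 first.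
  - by apply/(measurable_restrictT _ mD); exact: measurable_funS mg'.
  - by move=> x; apply: erestrict_ge0 => // y _; exact: g0'.
  rewrite [RHS]integral_mkcond; apply: eq_integral => x _.
  by rewrite /patch; case: ifPn => // _; rewrite mul0e.
move=> mk k0.
pose h := nnsfun_approx measurableT mk.
have kE x : k x = lim ((EFin \o h n) x @[n --> \oo]).
  by apply/esym/cvg_lim => //; apply: cvg_nnsfun_approx.
under eq_integral => x _ do rewrite kE.
under [RHS]eq_integral => x _.
  rewrite (_ : k x * _ = lim ((h n x)%:E * (f x)%:E @[n --> \oo])); last first.
    apply/esym/cvg_lim => //; apply: cvgeZr => //.
    by apply: cvg_nnsfun_approx.
  over.
rewrite monotone_convergence//; last 3 first.
- by move=> n; apply/measurable_EFinP.
- by move=> n x _; rewrite lee_fin.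
- by move=> x _ a b ab; rewrite lee_fin; exact/lefP/nd_nnsfun_approx.
rewrite monotone_convergence//; last 3 first.
- by move=> n; apply: emeasurable_funM => //; apply/measurable_EFinP.
- by move=> n x _; rewrite mule_ge0 ?lee_fin ?f_ge0.
- move=> x _ a b ab; rewrite lee_wpmul2r ?lee_fin ?f_ge0//.
  exact/lefP/nd_nnsfun_approx.
congr (lim (_ @ \oo)); apply/funext => n /=.
exact: integral_density_nnsfun.
Qed.

End density.

Section tuple_density.
Context {R : realType} (n : nat) (w : seq R -> R).
Hypothesis w_ge0 : forall s, 0 <= w s.
Hypothesis mw : seq_measurable n (EFin \o w).
Local Open Scope ereal_scope.

(** The indicator of a set of tuples, extended by [0] to sequences of other lengths so that
    [iter_integral] can take it. *)
Definition seq_indic (B : set (n.-tuple R)) (s : seq R) : \bar R :=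
  if (insub s : option (n.-tuple R)) is Some t then \d_t B else 0.

Lemma seq_indicE B (t : n.-tuple R) : seq_indic B (tval t) = \d_t B.
Proof. by rewrite /seq_indic valK. Qed.

Lemma seq_indic_ge0 B s : 0 <= seq_indic B s.
Proof. by rewrite /seq_indic; case: insub. Qed.

Lemma measurable_seq_indic B : measurable B ->
  seq_measurable n (seq_indic B).
Proof.
move=> mB; rewrite /seq_measurable; under eq_fun do rewrite seq_indicE diracE.
by apply/measurable_EFinP; exact: (measurable_indic mB).
Qed.

(** The measure on tuples with density [w] with respect to Lebesgue measure. It is registered as a
    measure below, so that uniqueness on boxes can identify it with a law. *)
Definition tuple_density (B : set (n.-tuple R)) : \bar R :=
  iter_integral n (fun s => (w s)%:E * seq_indic B s).

Let tuple_density0 : tuple_density set0 = 0.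
Proof.
transitivity (iter_integral n (fun s => 0 * (w s)%:E)).
  apply: eq_iter_integral => s sn.
  rewrite (_ : s = tval (Tuple (introT eqP sn)))// seq_indicE.
  by rewrite measure0 mule0 mul0e.
by rewrite iter_integralZl ?mul0e// => s; rewrite lee_fin.
Qed.

Let tuple_density_ge0 B : 0 <= tuple_density B.
Proof.
by apply: iter_integral_ge0 => s; rewrite mule_ge0 ?lee_fin// seq_indic_ge0.
Qed.

Let tuple_density_sigma_additive : semi_sigma_additive tuple_density.
Proof.
move=> F mF tF mUF.
have -> : tuple_density (\bigcup_k F k) = \sum_(0 <= k <oo) tuple_density (F k).
  rewrite /tuple_density -iter_integral_nneseries; last 2 first.
  - by move=> k s; rewrite mule_ge0 ?lee_fin// seq_indic_ge0.
  - by move=> k; apply: seq_measurableM => //; exact: measurable_seq_indic.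
  apply: eq_iter_integral => s sn.
  rewrite (_ : s = tval (Tuple (introT eqP sn)))// seq_indicE.
  rewrite measure_semi_bigcup// -nneseriesZl//.
  by apply: eq_eseriesr => k _; rewrite seq_indicE.
exact: is_cvg_nneseries.
Qed.

HB.instance Definition _ := isMeasure.Build _ _ _ tuple_density
  tuple_density0 tuple_density_ge0 tuple_density_sigma_additive.

End tuple_density.

(** * Law of the reference port followed by the other ports *)

Lemma emeasurable_prod {d} {T : measurableType d} {R : realType} (I : Type)
    (r : seq I) (A : pred I) (h : I -> T -> \bar R) :
  (forall i, A i -> measurable_fun setT (h i)) ->
  measurable_fun setT (fun x => \prod_(i <- r | A i) h i x)%E.
Proof.
move=> mh; elim: r => [|i r IH].
  by under eq_fun do rewrite big_nil; exact: measurable_cst.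
under eq_fun do rewrite big_cons; case: (boolP (A i)) => // Ai.
by apply: emeasurable_funM => //; exact: mh.
Qed.

Lemma dirac_box {R : realType} n (A : 'I_n -> set R) (t : n.-tuple R) :
  \d_t (box n A) = (\prod_(i < n) \1_(A i) (tnth t i))%:E :> \bar R.
Proof.
rewrite diracE; have [tA|tA] := boolP (t \in box n A).
  rewrite big1// => i _; rewrite indicE; move: tA; rewrite inE => /(_ i) Ai.
  by rewrite mem_set.
have [i nAi] : exists i, ~ A i (tnth t i).
  by apply/existsNP => tA'; move/negP: tA; apply; rewrite inE.
by rewrite (bigD1 i)//= indicE memNset// mul0r.
Qed.

Section joint_law.
Local Open Scope ereal_scope.
Context {d : measure_display} {Omega : measurableType d} {R : realType}.
Variables (P : probability Omega R) (M : nat).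
Variables (X0 : {RV P >-> R}) (X : 'I_M -> {RV P >-> R}).
Variables (f0 : R -> R) (f : R -> R -> R).
Hypothesis f0_ge0 : forall x, (0 <= f0 x)%R.
Hypothesis mf0 : measurable_fun setT f0.
Hypothesis f_ge0 : forall x0 x, (0 <= f x0 x)%R.
Hypothesis mf : measurable_fun setT (fun p : R * R => f p.1 p.2).
Hypothesis X0f0 : has_density X0 f0.
Hypothesis Xf : cond_iid_density X0 X f.

Local Notation leb := (@lebesgue_measure R).

Definition joint_density (s : seq R) : R :=
  (f0 (nth 0 s 0) * \prod_(i < M) f (nth 0 s 0) (nth 0 s i.+1))%R.

Lemma joint_density_ge0 s : (0 <= joint_density s)%R.
Proof. by rewrite mulr_ge0// prodr_ge0. Qed.

Let mf1 x0 : measurable_fun setT (f x0).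
Proof.
have mc : measurable_fun setT (fun x : R => (x0, x)).
  by apply/measurable_fun_pairP; split;
    [exact: measurable_cst|exact: measurable_id].
exact: (measurableT_comp mf mc).
Qed.

Lemma measurable_joint_density : seq_measurable M.+1 (EFin \o joint_density).
Proof.
apply/measurable_EFinP; apply: measurable_funM.
  exact: (measurableT_comp mf0 (measurable_nth _ _)).
apply: (@measurable_prod _ _ _ setT _ _
  (fun (i : 'I_M) (t : M.+1.-tuple R) => f (nth 0%R t 0) (nth 0%R t i.+1))).
move=> i _.
have mc : measurable_fun setT
    (fun t : M.+1.-tuple R => (nth 0%R t 0, nth 0%R t i.+1)).
  by apply/measurable_fun_pairP; split; exact: measurable_nth.
exact: (measurableT_comp mf mc).
Qed.

Lemma measurable_section_integral A : measurable A ->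
  measurable_fun setT (fun x0 => \int[leb]_(x in A) (f x0 x)%:E).
Proof.
move=> mA; under eq_fun do rewrite integral_mkcond.
apply: (@measurable_fun_fubini_tonelli_F _ _ _ _ R leb
  (fun p : R * R => (((EFin \o f p.1) \_ A) p.2))).
  rewrite (_ : (fun _ => _) = ((fun p : R * R => (f p.1 p.2)%:E) \_ (setT `*` A))).
    apply/(measurable_restrictT _ (measurableX measurableT mA)).
    by apply: measurable_funTS; exact/measurable_EFinP.
  apply/funext => -[x y]; rewrite /patch /=.
  congr (if _ then _ else _).
  by apply/idP/idP; rewrite !inE => // -[].
move=> p; apply: erestrict_ge0 => y _ /=; rewrite lee_fin; exact: f_ge0.
Qed.

Lemma cond_prob_box (A0 : set R) (A : 'I_M -> set R) :
  measurable A0 -> (forall m, measurable (A m)) ->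
  P [set w | A0 (X0 w) /\ forall m, A m (X m w)] =
  \int[leb]_(x0 in A0)
    ((\prod_(m < M) \int[leb]_(x in A m) (f x0 x)%:E) * (f0 x0)%:E).
Proof.
move=> mA0 mA; rewrite Xf//.
have mg : measurable_fun setT
    (fun x0 => \prod_(m < M) \int[leb]_(x in A m) (f x0 x)%:E).
  by apply: emeasurable_prod => m _; apply: measurable_section_integral; exact: mA.
have g0 x0 : 0 <= \prod_(m < M) \int[leb]_(x in A m) (f x0 x)%:E.
  apply: prode_ge0 => m _; apply: integral_ge0 => y _.
  by rewrite lee_fin.
(* The canonical measurable type on [R] and the one carrying [leb] have the
   same measurable sets but different displays. *)
rewrite (ge0_integral_pushforward (measurable_funP X0))//; last exact: measurable_funTS.
pose X0' : Omega -> measurableTypeR R := X0.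
have mX0' : measurable_fun setT X0' by exact: (measurable_funP X0).
rewrite -(integral_density _ (measurableTypeR R) (pushforward P X0') leb f0
  f0_ge0 mf0 X0f0 _ _ mA0 mg g0).
by rewrite (ge0_integral_pushforward mX0')//; exact: (measurable_funS measurableT _ mg).

Qed.

Variable js : M.-tuple 'I_M.
Hypothesis ujs : uniq js.

Definition reordering (w : Omega) : M.+1.-tuple R :=
  [the M.+1.-tuple R of X0 w :: [tuple of map (fun j => X j w) js]].

Lemma measurable_reordering : measurable_fun setT reordering.
Proof.
apply: measurable_cons; first exact: measurable_funP.
apply/measurable_fun_tnthP => i.
rewrite (_ : _ \o _ = X (tnth js i)); first exact: measurable_funP.
by apply/funext => w /=; rewrite tnth_map.
Qed.

(** By uniqueness it suffices to test boxes. There the conditional probability is a product over the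
    ports, and reindexing it along [js] changes nothing, so the law is the same for every order of
    the ports. *)
Lemma joint_law B : measurable B ->
  P (reordering @^-1` B) = tuple_density M.+1 joint_density B.
Proof.
move=> mB.
have mY := measurable_reordering.
have w0 := joint_density_ge0.
have mw := measurable_joint_density.
apply: (tuple_measure_unique _ (pushforward P reordering)
  (tuple_density M.+1 joint_density)) => //.
  have PT : P setT < +oo by rewrite probability_setT ltry.
  exact: PT.
move=> A mA; rewrite /pushforward.
(* A duplicate-free list of [M] indices meets every index; [s] below is the inverse of the
   permutation [js]. *)
have idx (m : 'I_M) : exists k : 'I_M, tnth js k = m.
  have mjs : m \in js.
    have [|_ ->] := uniq_min_size ujs (fun x _ => mem_enum 'I_M x);
      by rewrite ?mem_enum// size_enum_ord size_tuple.
  have mjs' := mjs; rewrite -index_mem size_tuple in mjs'.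
  by exists (Ordinal mjs'); rewrite (tnth_nth m) /= nth_index.
pose s m := sval (cid (idx m)).
have sK m : tnth js (s m) = m by rewrite /s; case: cid.
have tK : cancel (tnth js) s.
  by move=> k; apply: (tuple_uniqP _ ujs); rewrite sK.
pose A' m := A (lift ord0 (s m)).
transitivity (P [set w | A ord0 (X0 w) /\ forall m, A' m (X m w)]).
  congr (P _); apply/seteqP; split => w /=.
    move=> h; split; first by have := h ord0.
    move=> m; have := h (lift ord0 (s m)).
    by rewrite (tnth_nth 0%R)/= add0n (nth_map m) ?size_tuple// -tnth_nth sK.
  move=> [h0 h] i; case: (unliftP ord0 i) => [k|] ->//.
  have := h (tnth js k); rewrite /A' tK.
  by rewrite (tnth_nth 0%R)/= add0n (nth_map (tnth js k)) ?size_tuple// -tnth_nth.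
rewrite cond_prob_box//; last by move=> m; exact: mA.
rewrite /tuple_density /= integral_mkcond; apply: eq_integral => x0 _.
pose h i x := ((f x0 x)%:E * (\1_(A (inord i.+1)) x)%:E).
(* The indicator of the box factors over the coordinates, and each port factor is merged with its
   density into [h]. *)
have split_density t : size t = M ->
    (joint_density (x0 :: t))%:E * seq_indic M.+1 (box M.+1 A) (x0 :: t) =
    (\1_(A ord0) x0)%:E * ((f0 x0)%:E * \prod_(i < M) h i (nth 0%R t i)).
  move=> tM; have xt : size (x0 :: t) == M.+1 by rewrite /= tM.
  rewrite (_ : x0 :: t = tval (Tuple xt))// seq_indicE dirac_box big_ord_recl.
  rewrite /h; under [in RHS]eq_bigr do rewrite -EFinM.
  rewrite -(big_morph EFin (@EFinM R) (erefl _)) -!EFinM; congr EFin.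
  rewrite /joint_density big_split /= (tnth_nth 0%R) /=.
  under [X in (_ * (_ * X))%R = _]eq_bigr => i _.
    rewrite (tnth_nth 0%R) /= add0n (_ : lift ord0 i = inord i.+1); first over.
    by apply/val_inj; rewrite /= inordK// ltnS.
  ring.
rewrite /patch; case: ifPn => x0A; last first.
  transitivity (iter_integral M (fun s : seq R => 0 * cst 0 s)); last first.
    apply: eq_iter_integral => t tM.
    by rewrite mul0e split_density// indicE (negbTE x0A) mul0e.
  by rewrite iter_integralZl ?mul0e//; exact: measurable_cst.
have mh i : measurable_fun setT (h i).
  apply: emeasurable_funM; first exact/measurable_EFinP.
  by apply/measurable_EFinP/measurable_indic.
have h0 i x : 0 <= h i x by rewrite mule_ge0 ?lee_fin.
transitivity (iter_integral M (fun s =>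
    (f0 x0)%:E * \prod_(i < M) h i (nth 0%R s i))); last first.
  apply: eq_iter_integral => t tM.
  by rewrite split_density// indicE x0A mul1e.
rewrite iter_integralZl ?lee_fin//; last 2 first.
- by move=> t; apply: prode_ge0.
- exact: seq_measurable_prod.
rewrite iter_integral_prod// muleC; congr *%E.
rewrite (reindex (tnth js)) /=; last by exists s => k _.
apply: eq_bigr => k _; rewrite /A' tK integral_mkcond.
apply: eq_integral => x _; rewrite epatch_indic /h.
by rewrite (_ : inord k.+1 = lift ord0 k)//; apply/val_inj; rewrite /= inordK// ltnS.
Qed.

End joint_law.

(** * Gamma kernels and their convolutions *)

Section calculus.
Context {R : realType}.
Local Notation leb := (@lebesgue_measure R).
Implicit Types (f F : R -> R) (p q k n : nat).

Lemma derivable_continuous f : (forall x : R, derivable f x 1) -> continuous f.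
Proof.
by move=> df x; apply: differentiable_continuous; apply/derivable1_diffP.
Qed.

Lemma integral_itv_deriv F f (a b : R) : a <= b ->
  (forall x : R, is_derive x 1 F (f x)) -> (forall x : R, derivable f x 1) ->
  (\int[leb]_(x in `[a, b]) (f x)%:E = (F b - F a)%:E)%E.
Proof.
rewrite le_eqVlt => /predU1P[-> _ _|ab dF df].
  by rewrite set_itv1 integral_set1 subrr.
have dF' (x : R) : derivable F x 1 by case: (dF x).
have cF := derivable_continuous _ dF'.
rewrite (@continuous_FTC2 _ f F)//.
- exact/continuous_subspaceT/derivable_continuous.
- split=> [x _| |]; first exact: dF'.
    exact/cvg_at_right_filter/cF.
  exact/cvg_at_left_filter/cF.
- by move=> x _; rewrite derive1E; apply: derive_val.
Qed.

Lemma integral_itvy_deriv F f (a l : R) : (forall x, a <= x -> 0 <= f x) ->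
  (forall x : R, is_derive x 1 F (f x)) -> (forall x : R, derivable f x 1) ->
  F x @[x --> +oo] --> l ->
  (\int[leb]_(x in `[a, +oo[) (f x)%:E = (l - F a)%:E)%E.
Proof.
move=> f0 dF df Fl.
have dF' (x : R) : derivable F x 1 by case: (dF x).
rewrite (@ge0_continuous_FTC2y _ f F a l)//.
- exact/continuous_subspaceT/derivable_continuous.
- exact/cvg_at_right_filter/(derivable_continuous _ dF').
- by move=> x _; rewrite derive1E; apply: derive_val.
Qed.

(** Divided powers, for which differentiation lowers the index without any coefficient. *)
Definition mono p (y : R) : R := y ^+ p / p`!%:R.

(** For [0 <= y], both the Gamma density of shape [p + 1] and rate [1] at [y], and the probability
    that a Poisson variable of mean [y] equals [p]. *)
Definition gkernel p (y : R) : R := expR (- y) * mono p y.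

(** The Erlang survival function of shape [p + 1]; the derivatives of its terms telescope to
    [- gkernel p]. *)
Definition gtail p (y : R) : R := \sum_(k < p.+1) gkernel k y.

Lemma mono0 (y : R) : mono 0 y = 1.
Proof. by rewrite /mono expr0 fact0 divr1. Qed.

Lemma monoS0 p : mono p.+1 (0 : R) = 0.
Proof. by rewrite /mono expr0n mul0r. Qed.

Lemma mono_ge0 p (y : R) : 0 <= y -> 0 <= mono p y.
Proof. by move=> y0; rewrite divr_ge0// exprn_ge0. Qed.

Lemma is_derive_mono0 (y : R) : is_derive y 1 (mono 0) 0.
Proof.
rewrite (_ : mono 0 = cst 1); last by apply/funext => x; rewrite mono0.
exact: is_derive_cst.
Qed.

Lemma is_derive_monoS p (y : R) : is_derive y 1 (mono p.+1) (mono p y).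
Proof.
have -> : mono p.+1 = (p.+1`!%:R)^-1 \*: ((@id R) ^+ p.+1).
  by apply/funext => x; rewrite /mono mulrC; congr (_ * _); rewrite fctE.
apply: is_derive_eq.
rewrite /mono factS natrM /GRing.scale /= mulr1 -[id y]/y; field.
by rewrite -[1]/(1%:R) -natrD !pnatr_eq0 -lt0n fact_gt0.
Qed.

Lemma derivable_mono p (y : R) : derivable (mono p) y 1.
Proof. by case: p => [|p]; [case: (is_derive_mono0 y)|case: (is_derive_monoS p y)]. Qed.

Lemma is_derive_comp_affine F f (c e y : R) :
  (forall x : R, is_derive x 1 F (f x)) ->
  is_derive y 1 (fun x => F (c * x + e)) (f (c * y + e) * c).
Proof.
move=> dF.
have dg : is_derive y 1 (fun x : R => c * x + e) c.
  have -> : (fun x : R => c * x + e) = c \*: (@id R) + cst e.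
    by apply/funext => x; rewrite !fctE.
  by apply: is_derive_eq; rewrite addr0 /GRing.scale /= mulr1.
exact: (is_derive1_comp (dF _) dg).
Qed.

Lemma is_derive_expRN (y : R) : is_derive y 1 (fun x => expR (- x)) (- expR (- y)).
Proof.
have := is_derive_comp_affine _ _ (-1) 0 y (@is_derive_expR R).
rewrite mulN1r addr0 mulrN1.
by under eq_fun do rewrite mulN1r addr0.
Qed.

Lemma is_derive_gkernel0 (y : R) : is_derive y 1 (gkernel 0) (- gkernel 0 y).
Proof.
have dE := is_derive_expRN y; have dM := is_derive_mono0 y.
apply: is_derive_eq (is_deriveM dE dM) _.
by rewrite /gkernel /GRing.scale /=; ring.
Qed.

Lemma is_derive_gkernelS p (y : R) :
  is_derive y 1 (gkernel p.+1) (gkernel p y - gkernel p.+1 y).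
Proof.
have dE := is_derive_expRN y; have dM := is_derive_monoS p y.
apply: is_derive_eq (is_deriveM dE dM) _.
by rewrite /gkernel /GRing.scale /=; ring.
Qed.

Lemma derivable_gkernel p (y : R) : derivable (gkernel p) y 1.
Proof.
by case: p => [|p]; [case: (is_derive_gkernel0 y)|case: (is_derive_gkernelS p y)].
Qed.

Lemma is_derive_gtail p (y : R) : is_derive y 1 (gtail p) (- gkernel p y).
Proof.
elim: p => [|p IH].
  rewrite (_ : gtail 0 = gkernel 0); first exact: is_derive_gkernel0.
  by apply/funext => x; rewrite /gtail big_ord1.
have -> : gtail p.+1 = gtail p + gkernel p.+1.
  by apply/funext => x; rewrite /gtail big_ord_recr.
apply: is_derive_eq (is_deriveD IH (is_derive_gkernelS p y)) _.
by rewrite addrA addNr add0r.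
Qed.

Lemma gtail0 p : gtail p (0 : R) = 1.
Proof.
rewrite /gtail big_ord_recl big1 => [|i _].
  by rewrite /gkernel mono0 oppr0 expR0 mulr1 addr0.
by rewrite /gkernel monoS0 mulr0.
Qed.

Lemma gkernel_ge0 p (y : R) : 0 <= y -> 0 <= gkernel p y.
Proof. by move=> y0; rewrite mulr_ge0 ?expR_ge0 ?mono_ge0. Qed.

Lemma gtail_ge0 p (y : R) : 0 <= y -> 0 <= gtail p y.
Proof. by move=> y0; apply: sumr_ge0 => i _; exact: gkernel_ge0. Qed.

Lemma gkernel_cvg0 p : gkernel p (y : R) @[y --> +oo] --> (0 : R).
Proof.
apply/cvgr0Pnorm_le => e e0; near=> y.
have y0 : 0 < y by near: y; exact: nbhs_pinfty_gt.
rewrite ger0_norm ?gkernel_ge0 ?ltW//.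
have := @expR_ge1Dxn R y p (ltW y0) => h.
rewrite /gkernel expRN mulrC ltr_pdivrMr ?expR_gt0//.
(* The exponential exceeds its Taylor term of degree [p + 1], so the kernel is below [(p + 1) / y],
   which is at most [e] from this threshold on. *)
have hy : p.+1%:R / e <= y by near: y; apply: nbhs_pinfty_ge; exact: num_real.
apply: (@le_lt_trans _ _ (e * (y ^+ p.+1 / p.+1`!%:R))); last first.
  by rewrite ltr_pM2l//; apply: lt_le_trans h; rewrite ltrDr.
rewrite ler_pdivrMr// in hy.
have -> : e * (y ^+ p.+1 / p.+1`!%:R) = mono p y * (y * e / p.+1%:R).
  rewrite /mono factS natrM invfM exprS; ring.
apply: ler_peMr; first exact: (mono_ge0 _ _ (ltW y0)).
by rewrite ler_pdivlMr ?mul1r ?ltr0n.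
Unshelve. all: by end_near. Qed.

Lemma gtail_cvg0 p : gtail p (y : R) @[y --> +oo] --> (0 : R).
Proof.
elim: p => [|p IH].
  rewrite (_ : gtail 0 = gkernel 0); first exact: gkernel_cvg0.
  by apply/funext => x; rewrite /gtail big_ord1.
have -> : gtail p.+1 = (fun y => gtail p y + gkernel p.+1 y).
  by apply/funext => x; rewrite /gtail big_ord_recr.
by rewrite -[0]addr0; apply: cvgD => //; exact: gkernel_cvg0.
Qed.


(** The primitive in [y] of [mono p y * mono k (u - y)] obtained by integrating by parts [p] times.
    Its increment over [[0, u]] is the Beta integral [mono (p + k).+1 u]. *)
Fixpoint beta_prim p k (u y : R) : R :=
  if p is p'.+1 then beta_prim p' k.+1 u y - mono p y * mono k.+1 (u - y)
  else - mono k.+1 (u - y).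

Lemma is_derive_monoS_rev k (u y : R) :
  is_derive y 1 (fun x => mono k.+1 (u - x)) (- mono k (u - y)).
Proof.
have := is_derive_comp_affine _ _ (-1) u y (is_derive_monoS k).
rewrite mulrN1 mulN1r [- y + u]addrC.
by under eq_fun do rewrite mulN1r addrC.
Qed.

Lemma is_derive_beta_prim p k (u y : R) :
  is_derive y 1 (beta_prim p k u) (mono p y * mono k (u - y)).
Proof.
elim: p k => [|p IH] k.
  rewrite mono0 mul1r.
  apply: is_derive_eq (is_deriveN (is_derive_monoS_rev k u y)) _.
  by rewrite opprK.
have dM := is_deriveM (is_derive_monoS p y) (is_derive_monoS_rev k u y).
apply: is_derive_eq (is_deriveB (IH k.+1) dM) _.
rewrite /GRing.scale /=; ring.
Qed.

Lemma beta_prim_end p k (u : R) : beta_prim p k u u = 0.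
Proof.
elim: p k => [|p IH] k /=; first by rewrite subrr monoS0 oppr0.
by rewrite IH subrr monoS0 mulr0 subrr.
Qed.

Lemma beta_prim0 p k (u : R) : beta_prim p k u 0 = - mono (p + k).+1 u.
Proof.
elim: p k => [|p IH] k /=; first by rewrite subr0.
by rewrite IH subr0 monoS0 mul0r subr0 addnS addSn.
Qed.

Section gamma_convolution.
Variable omega : R.
Hypothesis omega_gt0 : 0 < omega.

Let omega_neq0 : omega != 0. Proof. by rewrite gt_eqF. Qed.

(** The Gamma density of shape [p + 1] and rate [omega] without its constant [omega ^+ p.+1]; the
    Erlang functions below omit the same constant. *)
Definition exp_mono p (y : R) : R := mono p y * expR (- (omega * y)).

Lemma exp_mono_gkernel p y : exp_mono p y = omega ^- p * gkernel p (omega * y).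
Proof.
rewrite /exp_mono /gkernel /mono exprMn; field.
by rewrite pnatr_eq0 -lt0n fact_gt0 expf_neq0.
Qed.

Definition exp_mono_prim p (y : R) : R := - (omega ^- p.+1 * gtail p (omega * y)).

Lemma is_derive_exp_mono_prim p (y : R) :
  is_derive y 1 (exp_mono_prim p) (exp_mono p y).
Proof.
have := is_derive_comp_affine _ _ omega 0 y (is_derive_gtail p).
rewrite addr0 => h.
have -> : exp_mono_prim p =
    (- omega ^- p.+1) \*: (fun x : R => gtail p (omega * x + 0)).
  by apply/funext => x; rewrite /exp_mono_prim /= addr0 /GRing.scale /= mulNr.
apply: is_derive_eq (is_deriveZ _ h) _.
rewrite /GRing.scale /= exp_mono_gkernel exprS; field.
by rewrite expf_neq0.
Qed.

Lemma derivable_exp_mono p (y : R) : derivable (exp_mono p) y 1.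
Proof.
apply: derivableM; first exact: derivable_mono.
have := is_derive_comp_affine _ _ (- omega) 0 y (@is_derive_expR R).
by case; under eq_fun do rewrite addr0 mulNr.
Qed.

Definition erlang q (u : R) : R := omega ^- q.+1 * (1 - gtail q (omega * u)).

Lemma erlangE q u : erlang q u = exp_mono_prim q u - exp_mono_prim q 0.
Proof. by rewrite /erlang /exp_mono_prim mulr0 gtail0; ring. Qed.

(** A primitive of the convolution integrand [exp_mono p y * erlang q (u - y)]: in the tail part the
    exponentials merge into [expR (- (omega * u))] and leave Beta integrands. *)
Definition erlang_conv_prim p q (u y : R) : R :=
  omega ^- q.+1 * (exp_mono_prim p y -
    expR (- (omega * u)) * \sum_(k < q.+1) omega ^+ k * beta_prim p k u y).

Lemma is_derive_erlang_conv_prim p q (u y : R) :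
  is_derive y 1 (erlang_conv_prim p q u) (exp_mono p y * erlang q (u - y)).
Proof.
have dS : is_derive y 1 (\sum_(k < q.+1) (omega ^+ k \*: beta_prim p k u))
    (\sum_(k < q.+1) (omega ^+ k *: (mono p y * mono k (u - y)))).
  apply: is_derive_sum => k; apply: is_deriveZ; exact: is_derive_beta_prim.
have := is_deriveZ (omega ^- q.+1) (is_deriveB (is_derive_exp_mono_prim p y)
  (is_deriveZ (expR (- (omega * u))) dS)).
have -> : omega ^- q.+1 \*: (exp_mono_prim p - expR (- (omega * u)) \*:
    (\sum_(k < q.+1) (omega ^+ k \*: beta_prim p k u))) = erlang_conv_prim p q u.
  apply/funext => x; rewrite /erlang_conv_prim /GRing.scale /= !fctE.
  by rewrite fct_sumE.
move=> h; apply: is_derive_eq h _.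
rewrite /GRing.scale /= /erlang /exp_mono.
rewrite mulrCA; congr (_ * _).
rewrite mulrBr mulr1; congr (_ - _).
rewrite /gtail !mulr_sumr; apply: eq_bigr => k _.
rewrite /gkernel.
have -> : expR (- (omega * u)) = expR (- (omega * y)) * expR (- (omega * (u - y))).
  by rewrite -expRD; congr expR; ring.
rewrite [mono k (omega * _)]/mono exprMn [mono k (u - y)]/mono; ring.
Qed.

Lemma derivable_erlang_conv p q (u y : R) :
  derivable (fun y => exp_mono p y * erlang q (u - y)) y 1.
Proof.
apply: derivableM; first exact: derivable_exp_mono.
have := is_derive_comp_affine _ _ (- omega) (omega * u) y (is_derive_gtail q).
case=> dg _; apply: derivableM; first exact: derivable_cst.
apply: derivableB; first exact: derivable_cst.
move: dg; under eq_fun do rewrite mulNr addrC -mulrBr.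
by [].
Qed.

(** The Beta increments are the terms of index [p + 1] to [p + q + 1] that complete [gtail p] to
    [gtail (p + q).+1]: convolution adds the shapes [p + 1] and [q + 1]. *)
Lemma erlang_conv_prim_diff p q u :
  erlang_conv_prim p q u u - erlang_conv_prim p q u 0 = erlang (p + q).+1 u.
Proof.
rewrite /erlang_conv_prim big1 => [|k _]; last by rewrite beta_prim_end mulr0.
under eq_bigr do rewrite beta_prim0.
rewrite /erlang /exp_mono_prim !mulr0 gtail0.
rewrite {2}/gtail -addSn -addnS big_split_ord /= -/(gtail p (omega * u)).
under [X in _ = _ * (1 - (_ + X))]eq_bigr => k _.
  rewrite /gkernel (_ : mono _ _ = omega ^+ p.+1 * (omega ^+ k * mono (p + k).+1 u)); last first.
    by rewrite /mono addSn exprMn -addSn exprD; ring.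
  rewrite mulrCA; over.
rewrite -mulr_sumr.
under eq_bigr do rewrite mulrN.
rewrite sumrN -mulr_sumr exprD.
have a0 : omega ^+ p.+1 != 0 by rewrite expf_neq0.
have b0 : omega ^+ q.+1 != 0 by rewrite expf_neq0.
move: (\sum_(i < _) _) (omega ^+ p.+1) (omega ^+ q.+1) a0 b0 => S a b a0 b0.
by field; rewrite ?a0 ?b0.
Qed.

End gamma_convolution.

End calculus.

(** * Definite integrals of Gamma kernels *)

Section gamma_integrals.
Context {R : realType}.
Local Notation leb := (@lebesgue_measure R).

Lemma derivable_comp_affine (f : R -> R) (c e y : R) :
  (forall x : R, derivable f x 1) ->
  derivable (fun x : R => f (c * x + e)) y 1.
Proof.
move=> df.
by have [] := is_derive_comp_affine f _ c e y (fun x => derivableP (df x)).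
Qed.

Lemma integral_itv_deriv_shift (F f : R -> R) (u v : R) : 0 <= u ->
  (forall x : R, is_derive x 1 F (f x)) -> (forall x : R, derivable f x 1) ->
  (\int[leb]_(x in `[v, (v + u)%R]) (f (x - v))%:E = (F u - F 0)%:E)%E.
Proof.
move=> u0 dF df.
have dF' (x : R) : is_derive x 1 (fun x : R => F (1 * x + - v)) (f (1 * x + - v)).
  by have := is_derive_comp_affine _ _ 1 (- v) x dF; rewrite mulr1.
have df' (x : R) : derivable (fun x : R => f (1 * x + - v)) x 1.
  exact: derivable_comp_affine.
have vu : v <= v + u by rewrite lerDl.
have := integral_itv_deriv _ _ v (v + u) vu dF' df'.
rewrite !mul1r subrr addrAC subrr add0r => <-.
by apply: eq_integral => x _; rewrite mul1r.
Qed.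

Lemma measurable_deriv (f : R -> R) : (forall x : R, derivable f x 1) ->
  measurable_fun setT f.
Proof.
move=> df; apply: continuous_measurable_fun; exact: derivable_continuous.
Qed.

Lemma lower_gamma_nat n (x : R) : 0 <= x ->
  lower_gamma n.+1%:R x = n`!%:R * (1 - gtail n x).
Proof.
move=> x0; rewrite /lower_gamma /Rintegral.
have df (t : R) : is_derive t 1 (n`!%:R \*: (- (@gtail R n))) (n`!%:R * gkernel n t).
  apply: is_derive_eq (is_deriveZ _ (is_deriveN (is_derive_gtail n t))) _.
  by rewrite opprK.
have df' (t : R) : derivable (fun t : R => n`!%:R * gkernel n t) t 1.
  by apply: derivableM; [exact: derivable_cst|exact: derivable_gkernel].
have := integral_itv_deriv _ _ 0 x x0 df df'.
rewrite /GRing.scale /= !fctE gtail0 => I.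
transitivity (fine (n`!%:R * - gtail n x - n`!%:R * - 1)%:E); last by rewrite /=; ring.
congr fine; rewrite -I; apply: eq_integral => t.
rewrite inE /= in_itv /= => /andP[t0 _]; congr EFin.
rewrite -natr1 addrK powR_mulrn// /gkernel /mono; field.
by rewrite pnatr_eq0 -lt0n fact_gt0.
Qed.

(** By the chain rule [- gtail k (t ^+ 2 / 2)] is a primitive. This is the form in which the Marcum
    function produces Erlang tails. *)
Lemma integral_gkernel_sqr k (b : R) : 0 <= b ->
  (\int[leb]_(t in `[b, +oo[) (t * gkernel k (t ^+ 2 / 2))%:E =
   (gtail k (b ^+ 2 / 2))%:E)%E.
Proof.
move=> b0.
have dsq (t : R) : is_derive t 1 (fun t : R => t ^+ 2 / 2) t.
  have -> : (fun t : R => t ^+ 2 / 2) = 2^-1 \*: ((@id R) ^+ 2).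
    by apply/funext => x; rewrite mulrC fctE.
  by apply: is_derive_eq; rewrite /GRing.scale /=; field.
have dF (t : R) : is_derive t 1 (fun t => - gtail k (t ^+ 2 / 2))
    (t * gkernel k (t ^+ 2 / 2)).
  apply: is_derive_eq (is_deriveN (is_derive1_comp (is_derive_gtail k _) (dsq t))) _.
  by rewrite mulNr opprK mulrC.
have df (t : R) : derivable (fun t : R => t * gkernel k (t ^+ 2 / 2)) t 1.
  apply: derivableM; first exact: derivable_id.
  by case: (@is_derive1_comp R (gkernel k) (fun t : R => t ^+ 2 / 2) t _ _
    (derivableP (derivable_gkernel k _)) (dsq t)).
have tl : - gtail k (t ^+ 2 / 2 : R) @[t --> +oo] --> (0 : R).
  rewrite -oppr0; apply: cvgN.
  apply: (@cvg_comp _ _ _ (fun t : R => t ^+ 2 / 2) (@gtail R k) _ (+oo_R)).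
    by apply: gt0_cvgMly => //; exact: cvgr_expr2.
  exact: gtail_cvg0.
rewrite (integral_itvy_deriv _ _ b 0 _ dF df tl); first by rewrite sub0r opprK.
move=> t bt; have t0 := le_trans b0 bt.
by rewrite mulr_ge0// gkernel_ge0// divr_ge0// sqr_ge0.
Qed.

Section rate.
Variable omega : R.
Hypothesis omega_gt0 : 0 < omega.

Lemma exp_mono_ge0 p y : 0 <= y -> 0 <= exp_mono omega p y.
Proof. by move=> y0; rewrite mulr_ge0 ?expR_ge0 ?mono_ge0. Qed.

Lemma integral_exp_monoy p (v : R) : 0 <= v ->
  (\int[leb]_(x in `[v, +oo[) (exp_mono omega p x)%:E =
   (omega ^- p.+1 * gtail p (omega * v))%:E)%E.
Proof.
move=> v0.
have tl : exp_mono_prim omega p t @[t --> +oo] --> (0 : R).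
  rewrite -oppr0 -[X in - X](mulr0 (omega ^- p.+1)); apply: cvgN.
  apply: cvgM; first exact: cvg_cst.
  apply: (@cvg_comp _ _ _ (fun t : R => omega * t) (@gtail R p) _ (+oo_R)).
    under eq_fun do rewrite mulrC.
    exact: (@gt0_cvgMly R (pinfty_nbhs R) _ omega id omega_gt0 (@cvg_id _ _)).
  exact: gtail_cvg0.
rewrite (integral_itvy_deriv _ _ v 0 _
  (is_derive_exp_mono_prim omega omega_gt0 p)
  (derivable_exp_mono omega p) tl).
  by rewrite sub0r opprK.
by move=> x vx; apply: exp_mono_ge0; exact: le_trans vx.
Qed.

(* The cumulative integral of [exp_mono (n - 1)]; index [0] stands for the unit
   mass at the origin, the neutral element of convolution. *)
Definition erlang_cdf n (u : R) : R :=
  if 0 <= u then (if n is q.+1 then erlang omega q u else 1) else 0.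

Lemma erlang_cdf_lt0 n u : u < 0 -> erlang_cdf n u = 0.
Proof. by move=> u0; rewrite /erlang_cdf leNgt u0. Qed.

Lemma measurable_erlang_cdf n : measurable_fun setT (erlang_cdf n).
Proof.
apply: measurable_fun_ifT => //.
- exact: measurable_fun_ler.
case: n => // q; apply: measurable_deriv => x.
rewrite (_ : erlang omega q = fun x => exp_mono_prim omega q x - exp_mono_prim omega q 0); last first.
  by apply/funext => y; rewrite erlangE.
apply: derivableB; last exact: derivable_cst.
by case: (is_derive_exp_mono_prim omega omega_gt0 q x).
Qed.

(** Convolution adds the shapes [p + 1] and [n]. As [erlang_cdf] vanishes at negative arguments,
    only [[v, v + u]] contributes, and it is empty when [u] is negative. *)
Lemma integral_exp_mono_erlang_cdf p n (u v : R) :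
  (\int[leb]_(x in `[v, +oo[)
     (exp_mono omega p (x - v) * erlang_cdf n (u - (x - v)))%:E =
   (erlang_cdf (p + n).+1 u)%:E)%E.
Proof.
have [u0|u0] := ltP u 0.
  rewrite erlang_cdf_lt0// integral0_eq// => x; rewrite /= in_itv/= andbT => vx.
  by rewrite erlang_cdf_lt0 ?mulr0//; lra.
transitivity (\int[leb]_(x in `[v, (v + u)%R]) (exp_mono omega p (x - v) *
    (if n is q.+1 then erlang omega q (u - (x - v)) else 1))%:E)%E.
  rewrite integral_mkcond [RHS]integral_mkcond; apply: eq_integral => x _.
  rewrite /patch !mem_setE !in_itv /= andbT.
  have [vx|//] := leP v x; have [xu|xu] := leP x (v + u).
    by rewrite /erlang_cdf; case: ifPn => //; case/negP; lra.
  by rewrite erlang_cdf_lt0 ?mulr0//; lra.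
(* Shape [0] is the unit mass, so only the integral of [exp_mono] is left. *)
case: n => [|q].
  under eq_integral do rewrite mulr1.
  rewrite (integral_itv_deriv_shift _ _ _ _ u0
    (is_derive_exp_mono_prim omega omega_gt0 p) (derivable_exp_mono omega p)).
  by rewrite /erlang_cdf u0 addn0 erlangE.
rewrite (integral_itv_deriv_shift _ _ _ _ u0
  (is_derive_erlang_conv_prim omega omega_gt0 p q u)
  (derivable_erlang_conv omega p q u)).
by rewrite /erlang_cdf u0 addnS erlang_conv_prim_diff.
Qed.

(** For a positive shape, the convolution formula with index [0] displays the value as the integral
    of a nonnegative function. *)
Lemma erlang_cdf_ge0 n u : 0 <= erlang_cdf n u.
Proof.
have [u0|u0] := ltP u 0; first by rewrite erlang_cdf_lt0.
case: n => [|q]; first by rewrite /erlang_cdf u0.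
have := integral_exp_mono_erlang_cdf q 0 u 0.
rewrite addn0 -lee_fin => <-; apply: integral_ge0 => x /=.
rewrite in_itv /= andbT subr0 lee_fin => x0.
by rewrite mulr_ge0 ?exp_mono_ge0// /erlang_cdf; case: ifP.
Qed.

Lemma lower_gamma_erlang_cdf n (u : R) : 0 <= u ->
  lower_gamma n.+1%:R (omega * u) / (n`!%:R * omega ^+ n.+1) =
  erlang_cdf n.+1 u.
Proof.
move=> u0; rewrite lower_gamma_nat; last by rewrite mulr_ge0// ltW.
rewrite /erlang_cdf u0 /erlang; field.
by rewrite ?expf_neq0 ?gt_eqF// ltr0n fact_gt0.
Qed.

End rate.

End gamma_integrals.

(** * Bessel series and port densities *)

Section bessel.
Context {R : realType}.
Local Notation leb := (@lebesgue_measure R).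
Implicit Types (u x y v a b : R) (k r : nat).

Lemma nneseries_limn (s : nat -> R) : cvgn (series s) ->
  ((limn (series s))%:E = \sum_(0 <= k <oo) (s k)%:E)%E.
Proof.
move=> cs; rewrite -EFin_lim//; congr (lim (_ @ \oo)).
by apply/funext => n /=; rewrite /series /= sumEFin.
Qed.

Definition bessel_term u k : R := u ^+ (2 * k) / (2 ^+ (2 * k) * k`!%:R ^+ 2).

Lemma bessel_term_ge0 u k : 0 <= bessel_term u k.
Proof.
apply: divr_ge0; last by rewrite mulr_ge0 ?exprn_ge0.
by rewrite exprM exprn_ge0// sqr_ge0.
Qed.

(** The terms are dominated by those of the exponential series at [(u / 2) ^+ 2], so the real series
    converges and its limit is the extended sum. *)
Lemma bessel_I0E u : ((bessel_I0 u)%:E = \sum_(0 <= k <oo) (bessel_term u k)%:E)%E.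
Proof.
apply: nneseries_limn.
apply: (@series_le_cvg _ _ (exp_coeff ((u / 2) ^+ 2))).
- exact: bessel_term_ge0.
- by move=> k; rewrite divr_ge0// exprn_ge0// sqr_ge0.
- move=> k; have k0 : k`!%:R != 0 :> R by rewrite pnatr_eq0 -lt0n fact_gt0.
  rewrite [X in X <= _](_ : _ = ((u / 2) ^+ 2) ^+ k / k`!%:R / k`!%:R); last first.
    rewrite -exprM expr_div_n; field.
    by rewrite k0 expf_neq0.
  apply: ler_piMr; first by rewrite divr_ge0// exprn_ge0// sqr_ge0.
  by rewrite invf_le1 ?ler1n ?ltr0n fact_gt0.
- exact: is_cvg_series_exp_coeff.
Qed.

Lemma bessel_I0_ge1 u : 1 <= bessel_I0 u.
Proof.
rewrite -lee_fin bessel_I0E.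
apply: le_trans (nneseries_lim_ge 1 _); last first.
  by move=> k _ _; rewrite lee_fin bessel_term_ge0.
by rewrite big_nat1 /bessel_term muln0 !expr0 fact0 expr1n mulr1 divr1.
Qed.

Lemma measurable_bessel_I0 : measurable_fun setT (@bessel_I0 R).
Proof.
apply/measurable_EFinP.
rewrite (_ : EFin \o _ = fun u => (\sum_(0 <= k <oo | k \in xpredT) (bessel_term u k)%:E)%E).
  apply: ge0_emeasurable_sum => [k u _ _|k _].
    by rewrite lee_fin bessel_term_ge0.
  apply/measurable_EFinP; apply: measurable_funM; last exact: measurable_cst.
  exact: exprn_measurable.
by apply/funext => u /=; rewrite bessel_I0E.
Qed.

Lemma nneseries_gkernel y : 0 <= y -> (\sum_(0 <= k <oo) (gkernel k y)%:E = 1)%E.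
Proof.
move=> y0.
rewrite (eq_eseriesr (g := fun k => ((expR (- y))%:E * (exp_coeff y k)%:E)%E)); last first.
  by move=> k _; rewrite -EFinM.
rewrite nneseriesZl; last first.
  by move=> k _; rewrite lee_fin divr_ge0// exprn_ge0.
rewrite -nneseries_limn; last exact: is_cvg_series_exp_coeff.
by rewrite -EFinM -/(expR y) -expRD addNr expR0.
Qed.

Lemma gtail_le1 k y : 0 <= y -> gtail k y <= 1.
Proof.
move=> y0; rewrite -lee_fin -(nneseries_gkernel y y0).
apply: le_trans (nneseries_lim_ge k.+1 _); last first.
  by move=> i _ _; rewrite lee_fin gkernel_ge0.
by rewrite /gtail -(big_mkord xpredT (fun k => gkernel k y)) sumEFin.
Qed.

(** For nonnegative arguments, the probability of exceeding [w] under a rate [1] Gamma law whose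
    shape is one plus a Poisson variable of mean [y]. *)
Definition poisson_tail (y w : R) : \bar R :=
  (\sum_(0 <= k <oo) (gkernel k y * gtail k w)%:E)%E.

Lemma poisson_tail_le1 y w : 0 <= y -> 0 <= w -> (poisson_tail y w <= 1)%E.
Proof.
move=> y0 w0; rewrite -(nneseries_gkernel y y0); apply: lee_nneseries.
  by move=> k _; rewrite lee_fin mulr_ge0 ?gkernel_ge0 ?gtail_ge0.
by move=> k _; rewrite lee_fin ler_piMr ?gkernel_ge0 ?gtail_le1.
Qed.

Lemma poisson_tail_ge0 y w : 0 <= y -> 0 <= w -> (0 <= poisson_tail y w)%E.
Proof.
move=> y0 w0; apply: nneseries_ge0 => k _ _.
by rewrite lee_fin mulr_ge0 ?gkernel_ge0 ?gtail_ge0.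
Qed.

Lemma poisson_tail0 y : 0 <= y -> poisson_tail y 0 = 1%E.
Proof.
move=> y0; rewrite /poisson_tail -[RHS](nneseries_gkernel y y0).
by apply: eq_eseriesr => k _; rewrite gtail0 mulr1.
Qed.

(** Expanding [bessel_I0] and integrating term by term gives a Poisson weight of mean [a ^+ 2 / 2]
    times an Erlang tail at [b ^+ 2 / 2]. *)
Lemma marcum_Q1E a b : 0 <= b ->
  ((marcum_Q1 a b)%:E = poisson_tail (a ^+ 2 / 2) (b ^+ 2 / 2))%E.
Proof.
move=> b0; have h y : 0 <= y ^+ 2 / 2 :> R by rewrite divr_ge0// sqr_ge0.
rewrite /marcum_Q1 /Rintegral.
(* The real integral is the [fine] part of the extended one, so the bound by [1] is used to know
   that the latter is finite. *)
suff -> : (\int[leb]_(t in `[b, +oo[)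
    (t * expR (- (t ^+ 2 + a ^+ 2) / 2) * bessel_I0 (a * t))%:E =
    poisson_tail (a ^+ 2 / 2) (b ^+ 2 / 2))%E.
  rewrite fineK// ge0_fin_numE ?poisson_tail_ge0//.
  by apply: le_lt_trans (poisson_tail_le1 _ _ (h _) (h _)) _; rewrite ltry.
pose g k t := ((gkernel k (a ^+ 2 / 2))%:E * (t * gkernel k (t ^+ 2 / 2))%:E)%E.
have mg k : measurable_fun setT (fun t : R => t * gkernel k (t ^+ 2 / 2)).
  apply: measurable_funM => //.
  apply: (@measurableT_comp _ _ _ _ _ _ (@gkernel R k)).
    by apply: measurable_deriv => x; exact: derivable_gkernel.
  by apply: measurable_funM => //; exact: exprn_measurable.
transitivity (\int[leb]_(t in `[b, +oo[) \sum_(0 <= k <oo) g k t)%E.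
  apply: eq_integral => t; rewrite inE /= in_itv /= andbT => bt.
  have t0 := le_trans b0 bt.
  rewrite EFinM bessel_I0E -nneseriesZl; last first.
    by move=> k _; rewrite lee_fin bessel_term_ge0.
  apply: eq_eseriesr => k _; rewrite /g -!EFinM; congr EFin.
  rewrite (_ : - (t ^+ 2 + a ^+ 2) / 2 = - (t ^+ 2 / 2) + - (a ^+ 2 / 2)); last by ring.
  rewrite expRD /gkernel /mono /bessel_term !expr_div_n exprMn -!exprM.
  rewrite [in 2 ^+ (2 * k)]exprM (_ : 2 ^+ 2 = 2 * 2 :> R); last by rewrite expr2.
  rewrite exprMn; field.
  by rewrite expf_neq0// pnatr_eq0 -lt0n fact_gt0.
rewrite integral_nneseries//; last 2 first.
- move=> k; apply: measurable_funTS; apply: emeasurable_funM => //.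
  by apply/measurable_EFinP; exact: mg.
- move=> k t /=; rewrite in_itv /= andbT => bt; have t0 := le_trans b0 bt.
  apply: mule_ge0; rewrite lee_fin; first by apply: gkernel_ge0; exact: h.
  by apply: mulr_ge0 => //; apply: gkernel_ge0; exact: h.
apply: eq_eseriesr => k _; rewrite /g ge0_integralZl//.
- by rewrite integral_gkernel_sqr// -EFinM.
- by apply: measurable_funTS; apply/measurable_EFinP; exact: mg.
- move=> t /=; rewrite in_itv /= andbT => bt; have t0 := le_trans b0 bt.
  by rewrite lee_fin; apply: mulr_ge0 => //; apply: gkernel_ge0; exact: h.
- by rewrite lee_fin; apply: gkernel_ge0; exact: h.
Qed.

End bessel.

Section port_density.
Context {R : realType}.
Local Notation leb := (@lebesgue_measure R).
Variables (omega mu : R).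
Hypothesis omega_gt0 : 0 < omega.
Hypothesis mu_ge0 : 0 <= mu.

Lemma port_density_ge0 x0 x : 0 <= port_density omega mu x0 x.
Proof.
rewrite /port_density /patch; case: ifP => // _.
apply: mulr_ge0; last by apply: le_trans (bessel_I0_ge1 _).
by rewrite mulr_ge0 ?expR_ge0// ltW.
Qed.

Lemma port_density_lt0 x0 x : x < 0 -> port_density omega mu x0 x = 0.
Proof.
by move=> x0'; rewrite /port_density /patch mem_setE in_itv/= leNgt x0'.
Qed.

Lemma measurable_port_density :
  measurable_fun setT (fun p : R * R => port_density omega mu p.1 p.2).
Proof.
rewrite (_ : (fun _ => _) = (fun p : R * R => if 0 <= p.2 then
   omega * expR (- omega * (p.2 + mu * p.1)) *
   bessel_I0 (2 * omega * Num.sqrt (mu * p.1 * p.2)) else 0)); last first.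
  by apply/funext => p; rewrite /port_density /patch mem_setE in_itv/= andbT.
apply: measurable_fun_ifT => //.
- by apply: measurable_fun_ler => //; exact: measurable_snd.
apply: measurable_funM.
  apply: measurable_funM => //; apply: measurableT_comp => //.
  apply: measurable_funM => //; apply: measurable_funD => //.
  exact: measurable_funM.
apply: measurableT_comp; first exact: measurable_bessel_I0.
apply: measurable_funM => //; apply: measurableT_comp.
  by apply: continuous_measurable_fun; exact: sqrt_continuous.
by apply: measurable_funM => //; exact: measurable_funM.
Qed.

(** The coefficient of [exp_mono omega r] in the port density: a Poisson weight of mean
    [omega * mu * x0] times the Erlang constant [omega ^+ r.+1]. *)
Definition port_weight x0 r : R :=
  expR (- (omega * mu * x0)) * dcoef omega mu r * x0 ^+ r.

Lemma port_weight_ge0 x0 r : 0 <= x0 -> 0 <= port_weight x0 r.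
Proof.
move=> x00; apply: mulr_ge0; last exact: exprn_ge0.
rewrite mulr_ge0 ?expR_ge0// /dcoef divr_ge0// mulr_ge0// exprn_ge0// ltW//.
Qed.

Lemma port_weightE x0 r :
  port_weight x0 r = gkernel r (omega * mu * x0) * omega ^+ r.+1.
Proof.
rewrite /port_weight /gkernel /mono /dcoef addn1 exprS mul2n -addnn exprD.
rewrite !exprMn exprS; ring.
Qed.

(** Only even powers occur in [bessel_I0], so the square root disappears and each term is a monomial
    in [x] times an exponential. *)
Lemma port_density_series x0 x : 0 <= x0 -> 0 <= x ->
  ((port_density omega mu x0 x)%:E =
   \sum_(0 <= r <oo) (port_weight x0 r * exp_mono omega r x)%:E)%E.
Proof.
move=> x00 xx0.
rewrite /port_density /patch mem_setE in_itv/= andbT xx0.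
rewrite EFinM bessel_I0E -nneseriesZl; last first.
  by move=> k _; rewrite lee_fin bessel_term_ge0.
apply: eq_eseriesr => k _; rewrite -EFinM; congr EFin.
rewrite /bessel_term /port_weight /dcoef /exp_mono /mono.
rewrite (_ : - omega * (x + mu * x0) = - (omega * x) + - (omega * mu * x0)); last by ring.
rewrite expRD addn1 exprS !exprMn exprM [(Num.sqrt _) ^+ _]exprM sqr_sqrtr; last first.
  by rewrite !mulr_ge0.
rewrite !exprMn [omega ^+ _.+1]exprS expr1; field.
by rewrite expf_neq0// pnatr_eq0 -lt0n fact_gt0.
Qed.

(** Termwise integration: the Erlang constants cancel, leaving Poisson weights times Erlang tails,
    the same series as for [marcum_Q1]. *)
Lemma integral_port_density_tail x0 v : 0 <= x0 -> 0 <= v ->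
  (\int[leb]_(x in `[v, +oo[) (port_density omega mu x0 x)%:E =
   poisson_tail (omega * mu * x0) (omega * v))%E.
Proof.
move=> x00 v0.
transitivity (\int[leb]_(x in `[v, +oo[) \sum_(0 <= r <oo)
    ((port_weight x0 r)%:E * (exp_mono omega r x)%:E))%E.
  apply: eq_integral => x; rewrite inE /= in_itv /= andbT => vx.
  by rewrite port_density_series// (le_trans v0).
have me r : measurable_fun setT (exp_mono omega r).
  by apply: measurable_deriv => x; exact: derivable_exp_mono.
rewrite integral_nneseries//; last 2 first.
- move=> k; apply: measurable_funTS; apply: emeasurable_funM => //.
  by apply/measurable_EFinP; exact: me.
- move=> k t /=; rewrite in_itv /= andbT => bt; have t0 := le_trans v0 bt.
  by rewrite mule_ge0// lee_fin ?port_weight_ge0 ?exp_mono_ge0.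
apply: eq_eseriesr => k _; rewrite ge0_integralZl//.
- rewrite integral_exp_monoy// -EFinM port_weightE; congr EFin; field.
  by rewrite expf_neq0// gt_eqF.
- by apply: measurable_funTS; apply/measurable_EFinP; exact: me.
- move=> t /=; rewrite in_itv /= andbT => bt; have t0 := le_trans v0 bt.
  by rewrite lee_fin exp_mono_ge0.
- by rewrite lee_fin port_weight_ge0.
Qed.

End port_density.

(** * Iterated sums and the upper ports *)

Section iterated_sum_theory.
Context {R : realType}.
Implicit Types (F G : seq nat -> R).

(** The bound on [sumn l] is made available because the shape [K + sumn r - sumn l] is a truncated
    subtraction. *)
Lemma eq_iter_sum rs F G :
  (forall l, size l = size rs -> (sumn l <= sumn rs)%N -> F l = G l) ->
  iter_sum rs F = iter_sum rs G.
Proof.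
elim: rs F G => [|r rs IH] F G FG /=; first exact: FG.
apply: eq_big_nat => l /andP[_ lr]; apply: IH => l' sl' ll'.
by apply: FG; rewrite /= ?sl'// leq_add.
Qed.

Lemma iter_sumZ rs c F : iter_sum rs (fun l => c * F l) = c * iter_sum rs F.
Proof.
elim: rs F => [//|r rs IH] F /=.
by rewrite mulr_sumr; apply: eq_bigr => l _; exact: IH.
Qed.

Lemma iter_sum_ge0 rs F : (forall l, 0 <= F l) -> 0 <= iter_sum rs F.
Proof.
elim: rs F => [|r rs IH] F F0 //=.
by apply: sumr_ge0 => l _; apply: IH => l'; exact: F0.
Qed.

Lemma measurable_iter_sum d (T : measurableType d) (D : set T) rs
    (F : seq nat -> T -> R) : (forall l, measurable_fun D (F l)) ->
  measurable_fun D (fun x => iter_sum rs (F ^~ x)).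
Proof.
elim: rs F => [|r rs IH] F mF /=; first exact: mF.
apply: (@measurable_sum _ _ _ D _ _ (fun l x => iter_sum rs (fun s => F (l :: s) x))) => l.
by apply: (IH (fun s => F (l :: s))) => l'; exact: mF.
Qed.

Lemma integral_iter_sum d (T : measurableType d) (m : {measure set T -> \bar R})
    (D : set T) rs (F : seq nat -> T -> R) G : measurable D ->
  (forall l, measurable_fun D (F l)) ->
  (forall l x, D x -> 0 <= F l x) ->
  (forall l, \int[m]_(x in D) (F l x)%:E = (G l)%:E)%E ->
  (\int[m]_(x in D) (iter_sum rs (F ^~ x))%:E = (iter_sum rs G)%:E)%E.
Proof.
move=> mD; elim: rs F G => [|r rs IH] F G mF F0 FG /=; first exact: FG.
have F0' l x : D x -> 0 <= iter_sum rs (fun s => F (l :: s) x).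
  by move=> Dx; apply: iter_sum_ge0 => s; exact: F0.
under eq_integral do rewrite -sumEFin.
have mF' l : measurable_fun D (fun x => (iter_sum rs (fun s => F (l :: s) x))%:E).
  apply/measurable_EFinP.
  by apply: (measurable_iter_sum _ _ _ _ (fun s => F (l :: s))) => s; exact: mF.
rewrite (ge0_integral_sum m mD mF'); last first.
  by move=> l x Dx; rewrite lee_fin; exact: F0'.
rewrite -sumEFin; apply: eq_bigr => l _.
apply: (IH (fun s => F (l :: s)) (fun s => G (l :: s))).
- by move=> s; exact: mF.
- by move=> s x Dx; exact: F0.
- by move=> s; exact: FG.
Qed.

Local Open Scope ereal_scope.

Lemma iter_series_ge0 K (F : seq nat -> \bar R) : (forall r, 0 <= F r) ->
  0 <= iter_series K F.
Proof.
elim: K F => [|K IH] F F0 //=.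
by apply: nneseries_ge0 => k _ _; apply: IH => r; exact: F0.
Qed.

Lemma eq_iter_series K (F G : seq nat -> \bar R) :
  (forall r, size r = K -> F r = G r) -> iter_series K F = iter_series K G.
Proof.
elim: K F G => [|K IH] F G FG /=; first exact: FG.
by apply: eq_eseriesr => k _; apply: IH => r rK; apply: FG; rewrite /= rK.
Qed.

Lemma iter_seriesZl K (c : R) (F : seq nat -> \bar R) : (forall r, 0 <= F r) ->
  iter_series K (fun r => c%:E * F r) = c%:E * iter_series K F.
Proof.
elim: K F => [|K IH] F F0 //=.
rewrite -nneseriesZl; last by move=> k _; apply: iter_series_ge0 => r; exact: F0.
by apply: eq_eseriesr => k _; apply: IH => r; exact: F0.
Qed.

Lemma measurable_iter_series d (T : measurableType d) (D : set T) K
    (F : seq nat -> T -> \bar R) : (forall r, measurable_fun D (F r)) ->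
  (forall r x, D x -> 0 <= F r x) ->
  measurable_fun D (fun x => iter_series K (F ^~ x)).
Proof.
elim: K F => [|K IH] F mF F0 /=; first exact: mF.
apply: (ge0_emeasurable_sum (P := xpredT)
  (h := fun k x => iter_series K (fun r => F (k :: r) x))).
  by move=> k x Dx _; apply: iter_series_ge0 => r; exact: F0.
move=> k _; apply: (IH (fun s => F (k :: s))) => r; first exact: mF.
exact: F0.
Qed.

Lemma integral_iter_series d (T : measurableType d)
    (m : {measure set T -> \bar R}) (D : set T) K
    (F : seq nat -> T -> \bar R) : measurable D ->
  (forall r, measurable_fun D (F r)) -> (forall r x, D x -> 0 <= F r x) ->
  \int[m]_(x in D) iter_series K (F ^~ x) =
  iter_series K (fun r => \int[m]_(x in D) F r x).
Proof.
move=> mD; elim: K F => [//|K IH] F mF F0 /=.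
rewrite integral_nneseries//.
- apply: eq_eseriesr => k _; apply: (IH (fun s => F (k :: s))) => r.
    exact: mF.
  exact: F0.
- move=> k; apply: (measurable_iter_series _ _ _ _ (fun s => F (k :: s))) => r.
    exact: mF.
  exact: F0.
- by move=> k x Dx; apply: iter_series_ge0 => r; exact: F0.
Qed.

(** Viewing the series as an integral for the counting measure allows [c] to be infinite. *)
Lemma ge0_nneseriesZr (c : \bar R) (u : nat -> \bar R) : 0 <= c ->
  (forall k, 0 <= u k) ->
  \sum_(0 <= k <oo) (u k * c) = (\sum_(0 <= k <oo) u k) * c.
Proof.
move=> c0 u0; rewrite -!ge0_integral_count//; last first.
  by move=> k; rewrite mule_ge0.
by rewrite ge0_integralZr.
Qed.

End iterated_sum_theory.

Section half_lines.
Context {R : realType}.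
Local Notation leb := (@lebesgue_measure R).
Local Open Scope ereal_scope.

(** The two comparisons differ only at the point [v], which is a null set; strict and weak events
    get the same probability for this reason. *)
Lemma integral_lteif_itvy (b : bool) (g : R -> \bar R) (v : R) :
  measurable_fun setT g ->
  \int[leb]_x ((v < x ?<= if b)%R%:R%:E * g x) = \int[leb]_(x in `[v, +oo[) g x.
Proof.
move=> mg; transitivity (\int[leb]_(x in [set` Interval (BSide b v) +oo%O]) g x).
  rewrite [RHS]integral_mkcond; apply: eq_integral => x _.
  rewrite /patch mem_setE itv_boundlr /= andbT.
  by case: b; rewrite /Order.lteif /= bnd_simp; case: ifPn => xv; rewrite ?mul1e ?mul0e.
case: b => //; apply: integral_itv_obnd_cbnd.
exact: measurable_funS mg.
Qed.

End half_lines.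

Section port_integrals.
Context {R : realType}.
Local Notation leb := (@lebesgue_measure R).
Variables (omega mu : R).
Hypothesis omega_gt0 : 0 < omega.
Hypothesis mu_ge0 : 0 <= mu.
Variables (x0 v : R).
Hypothesis x0_ge0 : 0 <= x0.
Hypothesis v_ge0 : 0 <= v.

Let port := port_density omega mu x0.

Let port_ge0 x : 0 <= port x. Proof. exact: port_density_ge0. Qed.

Lemma measurable_port_density_section : measurable_fun setT port.
Proof.
have mc : measurable_fun setT (fun x : R => (x0, x)).
  by apply/measurable_fun_pairP; split;
    [exact: measurable_cst|exact: measurable_id].
exact: (measurableT_comp (measurable_port_density omega mu) mc).
Qed.

Let mport := measurable_port_density_section.

Lemma measurable_lteif_cst (b : bool) (c : R) :
  measurable_fun setT (fun x : R => (x < c ?<= if b)%:R : R).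
Proof.
apply: (@measurableT_comp _ _ _ _ _ _ (fun B : bool => B%:R : R)) => //.
by case: b; [exact: measurable_fun_ler|exact: measurable_fun_ltr].
Qed.

Lemma measurable_cst_lteif (b : bool) (c : R) :
  measurable_fun setT (fun x : R => (c < x ?<= if b)%:R : R).
Proof.
apply: (@measurableT_comp _ _ _ _ _ _ (fun B : bool => B%:R : R)) => //.
by case: b; [exact: measurable_fun_ler|exact: measurable_fun_ltr].
Qed.

Lemma integral_port_density :
  (\int[leb]_x (port x)%:E = 1)%E.
Proof.
have lam0 : 0 <= omega * mu * x0 by rewrite !mulr_ge0// ltW.
rewrite -(poisson_tail0 _ lam0) -[X in poisson_tail _ X](mulr0 omega).
rewrite -integral_port_density_tail// [RHS]integral_mkcond.
apply: eq_integral => x _; rewrite /patch mem_setE in_itv/= andbT.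
by case: leP => // xlt; rewrite /port port_density_lt0.
Qed.

(** The comparisons given by [b] and [~~ b] are complementary, so this integral and the tail, which
    is [marcum_Q1], add up to the total mass [1]. *)
Lemma port_cdfE (b : bool) :
  (\int[leb]_x ((x < v ?<= if b)%R%:R * port x)%:E =
   (1 - marcum_Q1 (Num.sqrt (2 * omega * mu * x0)) (Num.sqrt (2 * omega * v)))%:E)%E.
Proof.
set F := (X in X = _).
have m1 : measurable_fun setT (fun x : R => ((x < v ?<= if b)%R%:R * port x)%:E).
  apply/measurable_EFinP; apply: measurable_funM; last exact: mport.
  exact: measurable_lteif_cst.
have m2 : measurable_fun setT (fun x : R => ((v < x ?<= if ~~ b)%R%:R * port x)%:E).
  apply/measurable_EFinP; apply: measurable_funM; last exact: mport.
  exact: measurable_cst_lteif.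
have FQ : (F + (marcum_Q1 (Num.sqrt (2 * omega * mu * x0))
    (Num.sqrt (2 * omega * v)))%:E = 1)%E.
  rewrite -integral_port_density marcum_Q1E// ?sqrtr_ge0//.
  rewrite !sqr_sqrtr ?mulr_ge0 ?(ltW omega_gt0)//.
  rewrite (_ : 2 * omega * mu * x0 / 2 = omega * mu * x0); last by field.
  rewrite (_ : 2 * omega * v / 2 = omega * v); last by field.
  rewrite -integral_port_density_tail//.
  rewrite -(integral_lteif_itvy (~~ b)); last by apply/measurable_EFinP; exact: mport.
  rewrite /F -ge0_integralD//.
  - apply: eq_integral => x _; rewrite -!EFinM -EFinD -mulrDl; congr EFin.
    suff -> : (x < v ?<= if b)%:R + (v < x ?<= if ~~ b)%:R = 1 :> R by rewrite mul1r.
    by case: b {F m1 m2} => /=; rewrite /Order.lteif/=; case: ltgtP => _ /=; rewrite ?addr0 ?add0r.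
  - by move=> x _; rewrite lee_fin mulr_ge0.
  - by move=> x _; rewrite lee_fin mulr_ge0.
(* The sum being [1] excludes infinite values of [F], after which the tail can be subtracted. *)
have Ffin : F \is a fin_num.
  rewrite fin_numE; apply/andP; split; apply/eqP => Foo.
    by move: FQ; rewrite Foo.
  by move: FQ; rewrite Foo.
move: FQ; move: (marcum_Q1 _ _) => Q; move: F Ffin => {m1 m2} [F| |]// _.
by rewrite -EFinD => -[<-]; rewrite addrK.
Qed.

(** The binomial formula for [x = v + (x - v)] in divided powers; the excess over [v] again has
    Gamma terms. *)
Lemma exp_mono_split r (x : R) :
  exp_mono omega r x = expR (- (omega * v)) *
    \sum_(0 <= l < r.+1) mono l v * exp_mono omega (r - l) (x - v).
Proof.
rewrite /exp_mono (_ : expR (- (omega * x)) =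
  expR (- (omega * v)) * expR (- (omega * (x - v)))); last first.
  by rewrite -expRD; congr expR; ring.
under eq_bigr do rewrite mulrA.
rewrite -mulr_suml mulrCA; congr (_ * _); congr (_ * _).
rewrite /mono -[X in X ^+ _](subrK v) exprDn big_mkord mulr_suml.
apply: eq_bigr => i _; have ir : (i <= r)%N by rewrite -ltnS.
rewrite -(bin_fact ir) -mulr_natr !natrM; field.
by rewrite !pnatr_eq0 -!lt0n !fact_gt0 bin_gt0 ir.
Qed.

(** The contribution of the series indices [rs] to the integral of the product of port densities
    over values above [v] with sum at most [s]. The excesses over [v] must then sum to at most
    [s - (size rs)%:R * v]. *)
Definition erlang_mixture (rs : seq nat) (s : R) : R :=
  (\prod_(r <- rs) port_weight omega mu x0 r) *
  expR (- (omega * (size rs)%:R * v)) *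
  iter_sum rs (fun l => (\prod_(k <- l) (k`!%:R)^-1) * v ^+ sumn l *
    erlang_cdf omega (size rs + sumn rs - sumn l) (s - (size rs)%:R * v)).

Let prodVfact_ge0 (l : seq nat) : 0 <= \prod_(k <- l) (k`!%:R)^-1 :> R.
Proof. by apply: prodr_ge0 => k _; rewrite invr_ge0. Qed.

Let prod_weight_ge0 (rs : seq nat) : 0 <= \prod_(r <- rs) port_weight omega mu x0 r.
Proof. by apply: prodr_ge0 => k _; exact: port_weight_ge0. Qed.

Lemma erlang_mixture_ge0 rs s : 0 <= erlang_mixture rs s.
Proof.
rewrite /erlang_mixture mulr_ge0//; first by rewrite mulr_ge0 ?expR_ge0.
apply: iter_sum_ge0 => l.
by rewrite mulr_ge0 ?erlang_cdf_ge0// mulr_ge0// exprn_ge0.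
Qed.

Lemma measurable_erlang_mixture rs : measurable_fun setT (erlang_mixture rs).
Proof.
apply: measurable_funM => //; apply: (@measurable_iter_sum R _ R setT rs (fun l s =>
  (\prod_(k <- l) (k`!%:R)^-1) * v ^+ sumn l *
  erlang_cdf omega (size rs + sumn rs - sumn l) (s - (size rs)%:R * v))) => l.
apply: measurable_funM => //.
apply: measurableT_comp; first exact: measurable_erlang_cdf.
exact: measurable_funB.
Qed.

(** Adding one port: its term is split around [v], and each piece is convolved with the Erlang
    functions of the previous ports. *)
Lemma integral_erlang_mixture r rs s :
  (\int[leb]_(x in `[v, +oo[)
    (port_weight omega mu x0 r * exp_mono omega r x *
      erlang_mixture rs (s - x))%:E = (erlang_mixture (r :: rs) s)%:E)%E.
Proof.
pose c := (\prod_(i <- r :: rs) port_weight omega mu x0 i) *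
  expR (- (omega * (size (r :: rs))%:R * v)).
pose u := s - (size (r :: rs))%:R * v.
pose a (l : seq nat) : R := (\prod_(k <- l) (k`!%:R)^-1) * v ^+ sumn l.
(* The summand is written for an arbitrary list, through [head] and [behead], since
   [integral_iter_sum] ranges over all lists; the lists met in the sum begin with the new index. *)
pose n (l : seq nat) := (size rs + sumn rs - sumn (behead l))%N.
pose F (l : seq nat) x := c * a l * (exp_mono omega (r - head 0%N l) (x - v) *
  erlang_cdf omega (n l) (u - (x - v))).
have c0 : 0 <= c by rewrite mulr_ge0 ?expR_ge0.
have a0 l : 0 <= a l by rewrite mulr_ge0 ?exprn_ge0.
transitivity (\int[leb]_(x in `[v, +oo[) (iter_sum (r :: rs) (F ^~ x))%:E)%E.
  apply: eq_integral => x _; congr EFin; rewrite (exp_mono_split r) /=.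
  rewrite !mulr_sumr mulr_suml.
  apply: eq_bigr => l _; rewrite /erlang_mixture mulrA -iter_sumZ.
  apply: eq_iter_sum => l' _ _.
  rewrite /F /= /n /= /a /= !big_cons /mono exprD.
  rewrite (_ : s - x - _ = u - (x - v)); last by rewrite /u /= -natr1; ring.
  rewrite /c /= big_cons -natr1.
  rewrite (_ : expR (- (omega * ((size rs)%:R + 1) * v)) =
     expR (- (omega * (size rs)%:R * v)) * expR (- (omega * v))); last first.
    by rewrite -expRD; congr expR; ring.
  ring.
rewrite (@integral_iter_sum _ _ _ _ _ _ _ (fun l =>
    c * a l * erlang_cdf omega ((r - head 0%N l) + n l).+1 u)) //.
- congr EFin; rewrite /= /erlang_mixture -iter_sumZ /=.
  apply: eq_big_nat => l /andP[_ lr]; apply: eq_iter_sum => l' _ ll'.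
  rewrite /n /= !mulrA; congr (_ * erlang_cdf _ _ _).
  (* The truncated subtractions agree because each summation index is bounded by its series
     index. *)
  by rewrite addnBA//; lia.
- move=> l; apply: measurable_funTS; apply: measurable_funM => //.
  have ms : measurable_fun setT (fun x : R => x - v) by exact: measurable_funB.
  apply: measurable_funM.
    apply: (measurableT_comp _ ms); apply: measurable_deriv => x.
    exact: derivable_exp_mono.
  apply: measurableT_comp; first exact: measurable_erlang_cdf.
  exact: measurable_funB.
- move=> l x /=; rewrite in_itv/= andbT => vx.
  rewrite /F mulr_ge0//; first exact: mulr_ge0.
  by rewrite mulr_ge0 ?erlang_cdf_ge0// exp_mono_ge0// subr_ge0.
- move=> l; rewrite EFinM -(integral_exp_mono_erlang_cdf _ omega_gt0 _ _ _ v).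
  rewrite -ge0_integralZl//.
  + apply: measurable_funTS; apply/measurable_EFinP.
    have ms : measurable_fun setT (fun x : R => x - v) by exact: measurable_funB.
    apply: measurable_funM.
      apply: (measurableT_comp _ ms); apply: measurable_deriv => x.
      exact: derivable_exp_mono.
    apply: measurableT_comp; first exact: measurable_erlang_cdf.
    exact: measurable_funB.
  + move=> x /=; rewrite in_itv/= andbT => vx; rewrite lee_fin.
    by rewrite mulr_ge0 ?erlang_cdf_ge0// exp_mono_ge0// subr_ge0.
  + by rewrite lee_fin mulr_ge0.
Qed.

Definition port_above (b : bool) (x : R) : R := (v < x ?<= if b)%:R * port x.

Lemma port_above_ge0 b x : 0 <= port_above b x.
Proof. exact: mulr_ge0. Qed.

Lemma measurable_port_above b : measurable_fun setT (port_above b).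
Proof.
by apply: measurable_funM; [exact: measurable_cst_lteif|exact: mport].
Qed.

Lemma seq_measurable_prod_sum_le n (g : R -> R) (s : R) :
  measurable_fun setT g ->
  seq_measurable n (fun a =>
    ((\prod_(x <- a) g x) * (\sum_(x <- a) x <= s)%R%:R)%:E).
Proof.
move=> mg; apply/measurable_EFinP; apply: measurable_funM.
  under eq_fun do rewrite big_tuple.
  apply: (@measurable_prod _ _ _ setT _ _
    (fun (i : 'I_n) (t : n.-tuple R) => g (tnth t i))) => i _.
  by apply: measurableT_comp => //; exact: measurable_tnth.
apply: (@measurableT_comp _ _ _ _ _ _ (fun B : bool => B%:R : R)) => //.
apply: measurable_fun_ler => //.
under eq_fun do rewrite big_tuple.
apply: (@measurable_sum _ _ _ setT _ _
  (fun (i : 'I_n) (t : n.-tuple R) => tnth t i)) => i.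
exact: measurable_tnth.
Qed.

(** Induction on the number of upper ports: a first value [x] leaves the bound [s - x] to the
    others, its density is expanded, and [integral_erlang_mixture] integrates each term. *)
Lemma iter_integral_port_above b K (s : R) :
  iter_integral K (fun a =>
    ((\prod_(x <- a) port_above b x) * (\sum_(x <- a) x <= s)%R%:R)%:E) =
  iter_series K (fun rs => (erlang_mixture rs s)%:E).
Proof.
elim: K s => [|K IH] s.
  rewrite /= !big_nil mul1r /erlang_mixture /= !big_nil mulr0 mul0r oppr0 expR0.
  by rewrite !mul1r addr0 /erlang_cdf /=; case: (0 <= s).
rewrite /=.
pose h (x : R) := iter_series K (fun rs => (erlang_mixture rs (s - x))%:E).
have mh : measurable_fun setT h.
  apply: (@measurable_iter_series R _ R setT K
    (fun rs x => (erlang_mixture rs (s - x))%:E)).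
    move=> rs; apply/measurable_EFinP.
    apply: measurableT_comp; first exact: measurable_erlang_mixture.
    exact: measurable_funB.
  by move=> rs x _; rewrite lee_fin erlang_mixture_ge0.
have h0 x : (0 <= h x)%E.
  by apply: iter_series_ge0 => rs; rewrite lee_fin erlang_mixture_ge0.
transitivity (\int[leb]_x ((v < x ?<= if b)%R%:R%:E * ((port x)%:E * h x)))%E.
  apply: eq_integral => x _.
  rewrite muleA -EFinM -[(_ * port x)%R]/(port_above b x) /h -IH.
  rewrite -iter_integralZl; last 3 first.
  - by rewrite lee_fin port_above_ge0.
  - move=> a; rewrite lee_fin mulr_ge0//; apply: prodr_ge0 => y _.
    exact: port_above_ge0.
  - by apply: seq_measurable_prod_sum_le; exact: measurable_port_above.
  apply: eq_iter_integral => a _; rewrite -EFinM !big_cons mulrA.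
  by rewrite lerBrDl.
rewrite (integral_lteif_itvy b (fun x => (port x)%:E * h x)%E); last first.
  by apply: emeasurable_funM => //; apply/measurable_EFinP; exact: mport.
have me r : measurable_fun setT (exp_mono omega r).
  by apply: measurable_deriv => x; exact: derivable_exp_mono.
have wx0 r x : v <= x -> 0 <= port_weight omega mu x0 r * exp_mono omega r x.
  move=> vx; rewrite mulr_ge0 ?port_weight_ge0 ?exp_mono_ge0//.
  exact: le_trans vx.
transitivity (\int[leb]_(x in `[v, +oo[) \sum_(0 <= r <oo)
    iter_series K (fun rs => (port_weight omega mu x0 r * exp_mono omega r x *
      erlang_mixture rs (s - x))%:E))%E.
  apply: eq_integral => x; rewrite inE /= in_itv /= andbT => vx.
  rewrite /port port_density_series//; last exact: le_trans vx.
  rewrite -ge0_nneseriesZr//; last by move=> k; rewrite lee_fin wx0.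
  apply: eq_eseriesr => r _; rewrite -iter_seriesZl.
    by apply: eq_iter_series => rs _; rewrite -EFinM.
  by move=> rs; rewrite lee_fin erlang_mixture_ge0.
have mF r rs : measurable_fun setT (fun x => (port_weight omega mu x0 r *
    exp_mono omega r x * erlang_mixture rs (s - x))%:E).
  apply/measurable_EFinP; apply: measurable_funM.
    exact: measurable_funM.
  apply: measurableT_comp; first exact: measurable_erlang_mixture.
  exact: measurable_funB.
have F0 r rs x : `[v, +oo[%classic x -> (0 <= (port_weight omega mu x0 r *
    exp_mono omega r x * erlang_mixture rs (s - x))%:E)%E.
  rewrite /= in_itv /= andbT => vx; rewrite lee_fin.
  by rewrite mulr_ge0 ?erlang_mixture_ge0 ?wx0.
rewrite integral_nneseries//; last 2 first.
- move=> r; apply: (@measurable_iter_series R _ (measurableTypeR R) _ K (fun rs x =>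
    (port_weight omega mu x0 r * exp_mono omega r x * erlang_mixture rs (s - x))%:E)).
    by move=> rs; apply: measurable_funTS; exact: mF.
  by move=> rs x; exact: F0.
- by move=> r x vx; apply: iter_series_ge0 => rs; exact: F0.
apply: eq_eseriesr => r _.
rewrite (@integral_iter_series R _ (measurableTypeR R) leb _ K (fun rs x =>
    (port_weight omega mu x0 r * exp_mono omega r x * erlang_mixture rs (s - x))%:E))//.
- by apply: eq_iter_series => rs _; exact: integral_erlang_mixture.
- by move=> rs; apply: measurable_funTS; exact: mF.
- by move=> rs x; exact: F0.
Qed.

End port_integrals.

(** * Integrand of the outage formula and probability of one event *)

Section outage_integrand.
Context {R : realType}.
Local Notation leb := (@lebesgue_measure R).
Variables (omega mu : R).
Hypothesis omega_gt0 : 0 < omega.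
Hypothesis mu_ge0 : 0 <= mu.
Variables (x0 v : R).
Hypothesis x0_ge0 : 0 <= x0.
Hypothesis v_ge0 : 0 <= v.

Let port := port_density omega mu x0.

(** Each of the [K] weights carries [expR (- (omega * mu * x0))], which [Phi] collects in front. All
    shapes are positive since [0 < K] and [sumn l <= sumn rs], and [K%:R * v <= z] turns the
    normalized lower Gamma values into [erlang_cdf]. *)
Lemma Phi_erlang_mixture K z : (0 < K)%N -> K%:R * v <= z ->
  Phi omega mu K z v x0 =
  iter_series K (fun rs => (erlang_mixture omega mu x0 v rs z)%:E).
Proof.
move=> K0 Kvz; rewrite /Phi.
have term_ge0 rs : 0 <= \prod_(k <- rs) dcoef omega mu k * x0 ^+ sumn rs.
  rewrite mulr_ge0 ?exprn_ge0//; apply: prodr_ge0 => k _.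
  by rewrite /dcoef divr_ge0// mulr_ge0// exprn_ge0// ltW.
have gam n : (0 < n)%N ->
    lower_gamma n%:R (omega * (z - K%:R * v)) / ((n - 1)`!%:R * omega ^+ n) =
    erlang_cdf omega n (z - K%:R * v).
  case: n => // n _; rewrite subn1 /= lower_gamma_erlang_cdf//.
  by rewrite subr_ge0.
rewrite -iter_seriesZl => [|rs]; last first.
  rewrite lee_fin mulr_ge0//; apply: iter_sum_ge0 => l /=.
  apply: mulr_ge0.
    by rewrite mulr_ge0 ?exprn_ge0// prodr_ge0// => k _; rewrite invr_ge0.
  apply: divr_ge0; last by rewrite mulr_ge0// exprn_ge0// ltW.
  by apply: Rintegral_ge0 => t _; rewrite mulr_ge0 ?expR_ge0 ?powR_ge0.
apply: eq_iter_series => rs rsK; rewrite -EFinM; congr EFin.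
rewrite /erlang_mixture rsK.
have -> : \prod_(r <- rs) port_weight omega mu x0 r =
    expR (- (omega * mu * x0)) ^+ K * (\prod_(k <- rs) dcoef omega mu k * x0 ^+ sumn rs).
  rewrite -rsK; elim: rs {rsK} => [|r rs IH]; first by rewrite !big_nil expr0 !mul1r.
  by rewrite !big_cons IH /port_weight /= exprS exprD; ring.
rewrite -expRM_natl.
rewrite (_ : - omega * (K%:R * v + K%:R * mu * x0) =
  K%:R * - (omega * mu * x0) + - (omega * K%:R * v)); last by ring.
rewrite expRD [LHS]mulrA [in RHS](mulrAC (expR _) (_ * _) (expR _)); congr (_ * _).
apply: eq_iter_sum => l lrs ll /=; rewrite -gam//.
by move: ll; lia.
Qed.

(** Every [erlang_cdf] is taken at the negative argument [z - K%:R * v]; this cuts the integral over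
    [v] at [z / K%:R]. *)
Lemma erlang_mixture_eq0 K z : z < K%:R * v ->
  iter_series K (fun rs => (erlang_mixture omega mu x0 v rs z)%:E) = 0%E.
Proof.
move=> zKv.
transitivity (iter_series K (fun _ : seq nat => 0%:E * (0 : \bar R)))%E.
  apply: eq_iter_series => rs rsK; rewrite mule0; congr EFin.
  rewrite /erlang_mixture (_ : iter_sum _ _ = 0) ?mulr0//.
  transitivity (0 * iter_sum rs (fun=> 0 : R)); last by rewrite mul0r.
  rewrite -iter_sumZ; apply: eq_iter_sum => l _ _.
  by rewrite rsK erlang_cdf_lt0 ?mulr0// subr_lt0.
by rewrite iter_seriesZl// mul0e.
Qed.

(** The first [K] entries are the upper ports, the remaining ones the lower ports, and [w] is the
    value of the separating port; [b] being true means weak inequalities. *)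
Definition top_cond (b : bool) K (z w : R) (s : seq R) : bool :=
  [&& all (fun x => w < x ?<= if b) (take K s),
      all (fun x => x < w ?<= if b) (drop K s)
    & \sum_(x <- take K s) x <= z].

Lemma prod_nat_of_bool (p : pred R) (s : seq R) :
  \prod_(x <- s) (p x)%:R = (all p s)%:R :> R.
Proof.
elim: s => [|x s IH]; first by rewrite big_nil.
by rewrite big_cons IH /=; case: (p x); rewrite ?mul1r ?mul0r.
Qed.

(** The condition factors over the two blocks: the lower ports give a power of the distribution
    function, which is [Psi], and the upper ports give the series. *)
Lemma iter_integral_top_cond b K T z c : 0 <= c ->
  iter_integral (K + T) (fun s =>
    ((c * \prod_(x <- s) port x) * (top_cond b K z v s)%:R)%:E) =
  (c%:E * iter_series K (fun rs => (erlang_mixture omega mu x0 v rs z)%:E) *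
   (Psi omega mu T v x0)%:E)%E.
Proof.
move=> c0; pose below x := (x < v ?<= if b)%:R * port x.
have below_ge0 x : 0 <= below x by rewrite mulr_ge0// port_density_ge0.
have mbelow : measurable_fun setT below.
  apply: measurable_funM; first exact: measurable_lteif_cst.
  exact: measurable_port_density_section.
have prod_ge0 (g : R -> R) a : (forall x, 0 <= g x) -> 0 <= \prod_(x <- a) g x.
  by move=> g0; apply: prodr_ge0.
have PsiE : iter_integral T (fun a => (\prod_(x <- a) below x)%:E) =
    (Psi omega mu T v x0)%:E.
  transitivity (iter_integral T (fun a =>
      \prod_(i < T) (fun _ : nat => EFin \o below) (i : nat) (nth 0%R a i))%E).
    apply: eq_iter_integral => a aT; rewrite (big_nth 0) aT big_mkord.
    by rewrite (big_morph EFin (@EFinM R) (erefl _)).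
  rewrite (iter_integral_prod T (fun _ : nat => EFin \o below)) => [|i x|i]; last 2 first.
  - by rewrite lee_fin.
  - exact/measurable_EFinP.
  under eq_bigr do rewrite /= port_cdfE//.
  rewrite -(big_morph EFin (@EFinM R) (erefl _)) prodr_const card_ord.
  by [].
rewrite iter_integral_cat -(iter_integral_port_above _ _ omega_gt0 mu_ge0 _ _ x0_ge0 v_ge0 b).
have mT : seq_measurable T (fun a => (\prod_(x <- a) below x)%:E).
  apply/measurable_EFinP; under eq_fun do rewrite big_tuple.
  apply: (@measurable_prod _ _ _ setT _ _
    (fun (i : 'I_T) (t : T.-tuple R) => below (tnth t i))) => i _.
  by apply: measurableT_comp => //; exact: measurable_tnth.
have P0 : (0 <= (Psi omega mu T v x0)%:E)%E.
  by rewrite -PsiE; apply: iter_integral_ge0 => a; rewrite lee_fin prod_ge0.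
rewrite muleAC -EFinM -iter_integralZl; last 3 first.
- by rewrite EFinM mule_ge0.
- move=> a; rewrite lee_fin mulr_ge0//; apply: prod_ge0 => x.
  by apply: port_above_ge0 => //.
- by apply: seq_measurable_prod_sum_le; exact: measurable_port_above.
apply: eq_iter_integral => a aK.
rewrite -EFinM mulrAC EFinM -PsiE -iter_integralZl; last 3 first.
- rewrite lee_fin mulr_ge0// mulr_ge0//; apply: prod_ge0 => x.
  by apply: port_above_ge0 => //.
- by move=> t; rewrite lee_fin prod_ge0.
- exact: mT.
apply: eq_iter_integral => t _; rewrite -EFinM; congr EFin.
rewrite /top_cond take_size_cat// drop_size_cat// big_cat /=.
rewrite /port_above /below !big_split /= !prod_nat_of_bool -/port.
by do 2 case: (all _ _); case: (_ <= z) => /=; ring.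
Qed.

End outage_integrand.

Section outage_integral.
Context {R : realType}.
Local Notation leb := (@lebesgue_measure R).

Lemma measurable_bool_set d (T : measurableType d) (f : T -> bool) :
  measurable_fun setT f -> measurable [set t | f t].
Proof.
by move=> mf; rewrite -[X in measurable X]setTI; exact: (mf measurableT [set true]).
Qed.

Lemma iter_integral0 n : iter_integral n (fun _ : seq R => 0%E) = 0%E.
Proof. by elim: n => [//|n IH] /=; rewrite IH integral0. Qed.

(** Coordinate [0] is the reference, coordinate [1] the separating port, then come [K] upper and [T]
    lower ports. *)
Definition top_event (b : bool) K T (z : R) : set ((K + T).+2.-tuple R) :=
  [set t | top_cond b K z (nth 0 t 1) (drop 2 t)].

Lemma measurable_top_event b K T z : measurable (top_event b K T z).
Proof.
pose cmp (c : bool) i j : set ((K + T).+2.-tuple R) :=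
  [set t | nth 0 t i < nth 0 t j ?<= if c].
have mcmp c i j : measurable (cmp c i j).
  apply: measurable_bool_set; case: c.
    by apply: measurable_fun_ler; exact: measurable_nth.
  by apply: measurable_fun_ltr; exact: measurable_nth.
rewrite (_ : top_event b K T z = \bigcap_(i in `I_K) cmp b 1 i.+2 `&`
    \bigcap_(i in `I_T) cmp b (K + i).+2 1 `&`
    [set t | \sum_(i < K) nth 0 t i.+2 <= z]).
  apply: measurableI; last first.
    apply: measurable_bool_set; apply: measurable_fun_ler => //.
    apply: (@measurable_sum _ _ _ setT _ _
      (fun (i : 'I_K) (t : (K + T).+2.-tuple R) => nth 0 t i.+2)) => i.
    exact: measurable_nth.
  by apply: measurableI; apply: fin_bigcap_measurable => //; exact: finite_II.
apply/seteqP; split => t.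
all: have st : size (drop 2 t) = (K + T)%N by rewrite size_drop size_tuple !subSS subn0.
all: have sk : size (take K (drop 2 t)) = K by rewrite size_takel// st leq_addr.
all: have sd : size (drop K (drop 2 t)) = T by rewrite size_drop st addKn.
all: have sumE : \sum_(x <- take K (drop 2 t)) x = \sum_(i < K) nth 0 t i.+2
  by rewrite (big_nth 0) sk big_mkord; apply: eq_bigr => i _; rewrite nth_take// nth_drop.
  rewrite /top_event /top_cond /= => /and3P[/(all_nthP 0) h1 /(all_nthP 0) h2 h3].
  split; last by rewrite /= -sumE.
  split => i /= ilt.
    by have := h1 i; rewrite sk nth_take// nth_drop; exact.
  by have := h2 i; rewrite sd !nth_drop; exact.
move=> [[h1 h2] h3]; apply/and3P; split; last by rewrite sumE.
  apply/(all_nthP 0) => i; rewrite sk => ilt; rewrite nth_take// nth_drop.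
  exact: h1.
apply/(all_nthP 0) => i; rewrite sd => ilt; rewrite !nth_drop.
exact: h2.
Qed.

Variables (omega mu : R) (f0 : R -> R).
Hypothesis omega_gt0 : 0 < omega.
Hypothesis mu_ge0 : 0 <= mu.
Hypothesis f0_ge0 : forall x, 0 <= f0 x.
Hypothesis f0_lt0 : forall x, x < 0 -> f0 x = 0.
Hypothesis mf0 : measurable_fun setT f0.

Lemma joint_density_cons M (f : R -> R -> R) (x0 : R) (s : seq R) : size s = M ->
  joint_density M f0 f (x0 :: s) = f0 x0 * \prod_(x <- s) f x0 x.
Proof.
by move=> sM; rewrite /joint_density (big_nth 0 _ (f x0)) sM big_mkord.
Qed.

(** The reference and the separating port remain as outer variables. Their densities vanish on
    negative values, and [erlang_mixture_eq0] removes [v] beyond [z / K%:R]. The right-hand side is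
    free of [b], so strict and weak events are equally likely. *)
Lemma tuple_density_top_event (b : bool) K T z (c : R) : (0 < K)%N -> 0 <= c ->
  (c%:E * tuple_density (K + T).+2
     (joint_density (K + T).+1 f0 (port_density omega mu)) (top_event b K T z) =
   \int[leb]_(x0 in `[0%R, +oo[) \int[leb]_(v in `[0%R, (z / K%:R)%R])
     (c%:E * Phi omega mu K z v x0 * (Psi omega mu T v x0)%:E
      * (port_density omega mu x0 v)%:E * (f0 x0)%:E))%E.
Proof.
move=> K0 c0; rewrite /tuple_density.
have port0 := port_density_ge0 omega mu omega_gt0.
have mport := measurable_port_density omega mu.
rewrite -iter_integralZl; last 3 first.
- by rewrite lee_fin.
- move=> s; rewrite mule_ge0 ?seq_indic_ge0// lee_fin.
  exact: joint_density_ge0.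
- apply: seq_measurableM; first exact: measurable_joint_density.
  apply: measurable_seq_indic; exact: measurable_top_event.
transitivity (iter_integral (K + T).+2 (fun s => (c * f0 (nth 0 s 0) *
    (\prod_(x <- behead s) port_density omega mu (nth 0 s 0) x) *
    (top_cond b K z (nth 0 s 1) (drop 2 s))%:R)%:E)).
  apply: eq_iter_integral => s ss.
  rewrite [s in seq_indic _ _ s](_ : s = tval (Tuple (introT eqP ss)))//.
  rewrite seq_indicE (_ : \d_ _ _ = (top_cond b K z (nth 0 s 1) (drop 2 s))%:R%:E).
    2: by rewrite diracE; congr ((nat_of_bool _)%:R%:E); apply/idP/idP; rewrite inE.
  case: s ss => [//|x0 s] [ss].
  by rewrite joint_density_cons// -!EFinM !mulrA.
rewrite /= [RHS]integral_mkcond; apply: eq_integral => x0 _.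
rewrite /patch mem_setE in_itv /= andbT.
have [x00|x00] := leP 0 x0; last first.
  rewrite integral0_eq// => v _.
  rewrite -[RHS](iter_integral0 (K + T)); apply: eq_iter_integral => s _.
  by rewrite f0_lt0// mulr0 !mul0r.
rewrite [RHS]integral_mkcond; apply: eq_integral => v _.
rewrite /patch mem_setE in_itv /=.
have Kgt0 : 0 < K%:R :> R by rewrite ltr0n.
have [v0|v0] := leP 0 v; last first.
  rewrite -[RHS](iter_integral0 (K + T)); apply: eq_iter_integral => s _.
  by rewrite big_cons port_density_lt0// mul0r mulr0 mul0r.
transitivity (iter_integral (K + T) (fun s =>
    ((c * f0 x0 * port_density omega mu x0 v) *
     (\prod_(x <- s) port_density omega mu x0 x) *
     (top_cond b K z v s)%:R)%:E)).
  apply: eq_iter_integral => s _.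
  by rewrite big_cons drop0 !mulrA.
rewrite iter_integral_top_cond//; last by rewrite !mulr_ge0.
rewrite ler_pdivlMr// [v * _]mulrC.
have [Kvz|Kvz] := leP (K%:R * v) z; last by rewrite erlang_mixture_eq0// mule0 mul0e.
rewrite (Phi_erlang_mixture _ _ omega_gt0 mu_ge0 _ _ x00 v0)// !EFinM.
by rewrite [LHS](ACl (1*4*5*3*2)%AC).
Qed.

End outage_integral.

(** * Bound on the correlation factor *)

Section correlation_bound.
Context {d : measure_display} {Omega : measurableType d} {R : realType}.
Local Notation leb := (@lebesgue_measure R).

Lemma prode_ninfty_neq1 n : (\prod_(i < n.+1) (-oo : \bar R) != 1)%E.
Proof.
suff : (\prod_(i < n.+1) (-oo : \bar R) = -oo \/ \prod_(i < n.+1) (-oo : \bar R) = +oo)%E.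
  by case=> ->.
elim: n => [|n IH]; first by left; rewrite big_ord1.
rewrite big_ord_recl; case: IH => ->; [right|left].
  by rewrite mulNyNy.
by rewrite mulNyy.
Qed.

(** For a negative rate, the exponential in [x] and [bessel_I0] are both at least [1], so the
    function stays below [- c] on the whole half-line. *)
Lemma integral_port_density_ninfty (omega mu x0 : R) : omega < 0 ->
  (\int[leb]_x (port_density omega mu x0 x)%:E = -oo)%E.
Proof.
move=> om0.
pose c := - omega * expR (- omega * (mu * x0)).
have c0 : 0 < c by rewrite mulr_gt0 ?expR_gt0// oppr_gt0.
have le x : 0 <= x -> c <= - port_density omega mu x0 x.
  move=> x0'; rewrite /port_density /patch mem_setE in_itv/= andbT x0'.
  rewrite -!mulNr mulrDr expRD /c.
  apply: (@le_trans _ _ (- omega * (expR (- omega * x) * expR (- omega * (mu * x0))))).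
    rewrite ler_pM2l ?oppr_gt0// ler_peMl ?expR_ge0//.
    by rewrite -expR0 ler_expR mulr_ge0// oppr_ge0 ltW.
  apply: ler_peMr; last exact: bessel_I0_ge1.
  by rewrite !mulr_ge0 ?expR_ge0// oppr_ge0 ltW.
have nport_ge0 x : 0 <= - port_density omega mu x0 x.
  have [x0'|x0'] := leP 0 x; first by apply: le_trans (ltW c0) (le _ _).
  by rewrite port_density_lt0// oppr0.
under eq_integral do rewrite -[port_density _ _ _ _]opprK EFinN.
rewrite integral_ge0N; last by move=> x _; rewrite lee_fin.
suff -> : (\int[leb]_x (- port_density omega mu x0 x)%:E = +oo)%E by [].
apply/eqP; rewrite -leye_eq.
apply: (@le_trans _ _ (\int[leb]_x ((fun=> c%:E) \_ `[0%R, +oo[) x)%E).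
  rewrite -integral_mkcond integral_cst//= lebesgue_measure_itv/= ltry.
  by rewrite mulry gtr0_sg// mul1e.
apply: ge0_le_integral => //.
- by move=> x _; rewrite /patch; case: ifP => // _; rewrite lee_fin ltW.
- by apply/(measurable_restrictT _ (measurable_itv _)); exact: measurable_cst.
- apply/measurable_EFinP; apply: measurableT_comp => //.
  exact: measurable_port_density_section.
- move=> x _; rewrite /patch mem_setE in_itv/= andbT; case: ifPn => [x0'|_].
    by rewrite lee_fin le.
  by rewrite lee_fin.
Qed.

Lemma correlation_lt1 (P : probability Omega R) M (X0 : {RV P >-> R})
    (X : 'I_M.+1 -> {RV P >-> R}) (phi mu : R) : 0 < phi ->
  cond_iid_density X0 X (port_density (phi * (1 - mu))^-1 mu) -> mu < 1.
Proof.
move=> phi0 Xf; rewrite ltNge; apply/negP => mu1.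
have := Xf setT (fun=> setT) measurableT (fun=> measurableT).
rewrite (_ : [set _ | _] = setT); last by apply/seteqP; split.
rewrite probability_setT => /esym.
(* On the full space the product of masses is a constant [k], whose integral against the law of [X0]
   is [k] itself and would have to be [1]. *)
suff [k k1 kE] : exists2 k : \bar R, (k != 1)%E & forall x0,
    (\prod_(m < M.+1) \int[leb]_x (port_density (phi * (1 - mu))^-1 mu x0 x)%:E = k)%E.
  under eq_integral do rewrite kE.
  rewrite (integral_cst (distribution P X0) measurableT) => k1'.
  have D1 : distribution P X0 setT = 1%E by exact: (probability_setT P).
  have kD : (k * distribution P X0 setT = k)%E by rewrite D1 mule1.
  by move/eqP: k1; apply; rewrite -kD; exact: k1'.
(* At [mu = 1] the rate is the inverse of [0], which is [0] by convention, and the density vanishes;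
   beyond [1] the rate is negative. *)
move: mu1; rewrite le_eqVlt => /predU1P[<-|mu1].
  exists 0%E; first by rewrite eq_sym onee_neq0.
  move=> x0; rewrite subrr mulr0 invr0 big_ord_recl integral0_eq ?mul0e// => x _.
  by rewrite /port_density /patch; case: ifP => // _; rewrite !mul0r.
exists (\prod_(i < M.+1) (-oo : \bar R))%E; first exact: prode_ninfty_neq1.
move=> x0; apply: eq_bigr => i _; apply: integral_port_density_ninfty.
by rewrite invr_lt0 pmulr_rlt0// subr_lt0.
Qed.

End correlation_bound.

(** * Decomposition of the outage event *)

Section top_indices_theory.
Context {R : realType} {M : nat}.
Implicit Types (x : 'I_M -> R) (A B : {set 'I_M}) (K : nat).

(** Exchange argument: [A :\: B] and [B :\: A] have the same size, and every value on the former is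
    at least the largest value on the latter. *)
Lemma sum_top_indices_max K x A B : top_indices K x A -> #|B| = K ->
  \sum_(i in B) x i <= \sum_(i in A) x i.
Proof.
move=> [AK topA] BK.
have cardE : #|B :\: A| = #|A :\: B|.
  apply/eqP; rewrite -(eqn_add2l #|A :&: B|) cardsID AK -BK.
  by rewrite -(cardsID A B) finset.setIC.
rewrite [leLHS](big_setID A) [leRHS](big_setID B) /= finset.setIC lerD2l.
have [BA0|[b0 b0BA]] := finset.set_0Vmem (B :\: A).
  by move/esym/eqP: cardE; rewrite BA0 cards0 cards_eq0 => /eqP ->; rewrite !big_set0.
case: (arg_maxP x b0BA) => b bBA bmax.
apply: (@le_trans _ _ (\sum_(i in B :\: A) x b)).
  by apply: ler_sum => i iBA; exact: bmax.
rewrite sumr_const cardE -sumr_const; apply: ler_sum => i iAB.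
have /finset.setDP[iA _] : i \in A :\: B by exact: iAB.
by have /finset.setDP[_ bA] : b \in B :\: A by []; exact: topA.
Qed.

Definition separates (s : bool) x A (j : 'I_M) : Prop :=
  (forall i, i \in A -> x j < x i ?<= if s) /\
  (forall i, i \notin A -> i != j -> x i < x j ?<= if s).

Lemma separates_top_indices s K x A j : #|A| = K -> j \notin A ->
  separates s x A j -> top_indices K x A.
Proof.
move=> AK jA [hi lo]; split=> // i k iA kA.
have {hi}ji : x j <= x i by apply: lteifW (hi _ iA).
have [->//|kj] := eqVneq k j.
by apply: le_trans ji; apply: lteifW (lo _ kA kj).
Qed.

(** An index [i] of [B] outside [A] forces some [k] of [A] outside [B], and then
    [x k <= x i <= x j < x k]. *)
Lemma strict_separates_unique K x A B j : j \notin A ->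
  separates false x A j -> #|A| = K -> top_indices K x B -> B = A.
Proof.
move=> jA [hi lo] AK [BK topB]; apply/eqP; rewrite eqEcard BK AK leqnn andbT.
apply/fintype.subsetP => i iB; apply/negPn/negP => iA.
have [k] : exists k, k \in A :\: B.
  apply/finset.set0Pn; rewrite -card_gt0.
  have := cardsID A B; rewrite BK => BKE.
  have := cardsID B A; rewrite AK finset.setIC => AKE.
  have : (0 < #|B :\: A|)%N by rewrite card_gt0; apply/finset.set0Pn; exists i; rewrite finset.in_setD iA.
  by lia.
rewrite finset.in_setD => /andP[kB kA].
have xki := topB _ _ iB kB; have xjk := hi _ kA.
have xij : x i <= x j.
  by have [->//|ij] := eqVneq i j; apply: lteifW (lo _ iA ij).
by have := le_lt_trans (le_trans xki xij) xjk; rewrite ltxx.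
Qed.

(** Take [j] of maximal value outside [A]; because of possible ties this only gives weak
    inequalities. *)
Lemma exists_separates K x A : (#|A| < M)%N -> top_indices K x A ->
  exists2 j, j \notin A & separates true x A j.
Proof.
move=> AM [AK topA].
have [j0 j0A] : exists j, j \in ~: A.
  by apply/finset.set0Pn; rewrite -card_gt0 cardsCs finset.setCK card_ord subn_gt0.
case: (arg_maxP x j0A) => j jA' jmax.
have jA : j \notin A by have : j \in ~: A by []; rewrite finset.in_setC.
exists j => //; split=> i iA; first exact: topA.
move=> _; apply: jmax.
have : i \in ~: A by rewrite finset.in_setC.
exact.
Qed.

End top_indices_theory.

Lemma sume_const_seq {R : realType} (I : Type) (r : seq I) (q : \bar R) :
  (\sum_(i <- r) q = (size r)%:R%:E * q)%E.
Proof.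
elim: r => [|i r IH]; first by rewrite big_nil mul0e.
by rewrite big_cons IH /= -nat1r EFinD ge0_muleDl ?lee_fin// mul1e.
Qed.

Section outage_events.
Context {d : measure_display} {Omega : measurableType d} {R : realType}.
Variables (P : probability Omega R) (K T : nat).
Local Notation M := (K + T).+1.
Variables (X0 : {RV P >-> R}) (X : 'I_M -> {RV P >-> R}) (z : R).

Definition separation_event (s : bool) (p : {set 'I_M} * 'I_M) : set Omega :=
  [set w | separates s (X ^~ w) p.1 p.2 /\ \sum_(i in p.1) X i w <= z].

Definition separators : {set {set 'I_M} * 'I_M} :=
  [set p : {set 'I_M} * 'I_M | (#|p.1| == K) && (p.2 \notin p.1)].

(** There are ['C(M, K)] choices of the set and then [M - K = T.+1] choices of an index outside
    it. *)
Lemma card_separators : #|separators| = ('C(M, K) * T.+1)%N.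
Proof.
rewrite -sum1_card.
rewrite (eq_bigl (fun p : {set 'I_M} * 'I_M => (#|p.1| == K) && (p.2 \notin p.1))); last first.
  by move=> p; rewrite inE.
rewrite -(pair_big_dep (fun A : {set 'I_M} => #|A| == K) (fun A j => j \notin A)
  (fun _ _ => 1%N)) /=.
rewrite (eq_bigr (fun=> T.+1)); last first.
  move=> A /eqP AK.
  transitivity #|[predC A]|; first by rewrite sum1_card; apply: eq_card.
  have := cardC A; rewrite card_ord AK => h.
  by apply: (@addnI K); rewrite h addnS.
have draws : #|[set A : {set 'I_M} | #|A| == K]%SET| = 'C(M, K).
  by rewrite card_draws card_ord.
rewrite sum_nat_const -draws; congr (_ * _)%N; apply: eq_card => A.
by rewrite !inE.
Qed.

(** The port order that [top_event] expects after the reference: separating port, upper ports, lower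
    ports. *)
Definition separator_order (p : {set 'I_M} * 'I_M) : seq 'I_M :=
  p.2 :: enum p.1 ++ enum (~: (p.2 |: p.1)).

Lemma size_separator_order p : p \in separators -> size (separator_order p) == M.
Proof.
rewrite inE => /andP[/eqP AK jA].
rewrite /separator_order /= size_cat -!cardE cardsCs finset.setCK cardsU1 jA AK card_ord.
by apply/eqP; lia.
Qed.

Lemma uniq_separator_order p : p \in separators -> uniq (separator_order p).
Proof.
rewrite inE => /andP[_ jA]; rewrite /= mem_cat !mem_enum !inE eqxx negb_or jA /=.
rewrite cat_uniq !enum_uniq andbT /=; apply/hasPn => i; rewrite !mem_enum !inE.
by rewrite negb_or => /andP[].
Qed.

Lemma separation_eventE s p w : p \in separators ->
  separation_event s p w <->
  top_cond s K z (X p.2 w)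
    [seq X i w | i <- enum p.1 ++ enum (~: (p.2 |: p.1))].
Proof.
rewrite inE => /andP[/eqP AK jA].
rewrite /top_cond map_cat take_size_cat ?drop_size_cat ?size_map -?cardE//.
rewrite !all_map big_map big_enum /=; split.
  move=> [[hi lo] le]; apply/and3P; split=> //; apply/allP => i; rewrite mem_enum.
    exact: hi.
  by rewrite !inE negb_or => /andP[ij iA]; exact: lo.
move=> /and3P[/allP hi /allP lo le]; split=> //; split=> i iA.
  by apply: hi; rewrite mem_enum.
by move=> ij; apply: lo; rewrite mem_enum !inE negb_or ij.
Qed.

Variables (f0 : R -> R) (f : R -> R -> R).
Hypothesis f0_ge0 : forall x, 0 <= f0 x.
Hypothesis mf0 : measurable_fun setT f0.
Hypothesis f_ge0 : forall x0 x, 0 <= f x0 x.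
Hypothesis mf : measurable_fun setT (fun p : R * R => f p.1 p.2).
Hypothesis X0f0 : has_density X0 f0.
Hypothesis Xf : cond_iid_density X0 X f.

Let separation_event_preimage s p (ps : p \in separators) :
  separation_event s p =
  reordering P M X0 X (Tuple (size_separator_order p ps)) @^-1` top_event s K T z.
Proof.
apply/seteqP; split => w.
  by move/(separation_eventE s p w ps); rewrite /preimage /top_event /= drop0.
rewrite /preimage /top_event /= drop0 => h.
exact/(separation_eventE s p w ps).
Qed.

Lemma measurable_separation_event s p : p \in separators ->
  measurable (separation_event s p).
Proof.
move=> ps; rewrite separation_event_preimage -[X in measurable X]setTI.
by apply: measurable_reordering => //; exact: measurable_top_event.
Qed.

Lemma prob_separation_event s p : p \in separators ->
  P (separation_event s p) =
  tuple_density (K + T).+2 (joint_density M f0 f) (top_event s K T z).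
Proof.
move=> ps; rewrite separation_event_preimage.
apply: joint_law => //; first exact: uniq_separator_order.
exact: measurable_top_event.
Qed.

Variable KK : Omega -> {set 'I_M}.
Hypothesis topKK : forall w, top_indices K (fun m => X m w) (KK w).

Let outage : set Omega := [set w | \sum_(m in KK w) X m w <= z].

(** [KK] is an arbitrary choice function, so the event is rewritten as a finite intersection over
    all [K]-subsets, whose sums are dominated by the sum over [KK w]. *)
Lemma measurable_outage : measurable outage.
Proof.
rewrite (_ : outage = \bigcap_(A in [set A : {set 'I_M} | #|A| = K])
    [set w | \sum_(m in A) X m w <= z]).
  apply: fin_bigcap_measurable; first exact: finite_finset.
  move=> A _; apply: measurable_bool_set; apply: measurable_fun_ler => //.
  under eq_fun do rewrite -big_enum /=.
  apply: (@measurable_sum _ _ _ setT _ _ (fun i w => X i w)) => i.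
  exact: measurable_funP.
apply/seteqP; split => w /= h; last by apply: h; case: (topKK w).
move=> A AK; apply: le_trans h; exact: sum_top_indices_max (topKK w) AK.
Qed.

Lemma prob_outage q :
  (forall s, tuple_density (K + T).+2 (joint_density M f0 f) (top_event s K T z) = q) ->
  P outage = (('C(M, K) * T.+1)%:R%:E * q)%E.
Proof.
move=> Eq.
pose S := [set` enum separators].
have finS : finite_set S by exact: finite_seq.
have inS p : S p -> p \in separators by rewrite /S /= mem_enum.
have mS s p : S p -> measurable (separation_event s p).
  by move/inS; exact: measurable_separation_event.
have sumE s : (\sum_(p \in S) P (separation_event s p) = ('C(M, K) * T.+1)%:R%:E * q)%E.
  rewrite -fsbig_seq ?enum_uniq// -card_separators cardE -sume_const_seq.
  apply: eq_big_seq => p; rewrite mem_enum => ps.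
  by rewrite prob_separation_event.
have topM w : (#|KK w| < M)%N by case: (topKK w) => -> _; rewrite ltnS leq_addr.
apply/eqP; rewrite eq_le; apply/andP; split.
  (* Upper bound: the weak events cover the outage event, and subadditivity applies. *)
  rewrite -(sumE true); apply: content_sub_fsum => //; first exact: mS.
    exact: measurable_outage.
  move=> w ow; have [j jK sep] := exists_separates _ _ _ (topM w) (topKK w).
  exists (KK w, j) => //=.
  by rewrite /S /= mem_enum inE /= jK andbT; case: (topKK w) => ->.
(* Lower bound: the strict events are disjoint, so their probabilities add up, and each is contained
   in the outage event. *)
rewrite -(sumE false) -measure_fin_bigcup//; last 2 first.
(* If two strict events meet, their sets coincide by uniqueness; two distinct separating indices
   outside that set would each lie strictly below the other. *)
- move=> p p' /inS + /inS +; rewrite !inE => /andP[/eqP AK jA] /andP[/eqP AK' jA'].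
  move=> [w [[sep _] [sep' _]]].
  have EA : p.1 = p'.1.
    apply: (strict_separates_unique K (X ^~ w)) sep' AK' _ => //.
    exact: separates_top_indices AK jA sep.
  case: p p' AK jA AK' jA' sep sep' EA => [A j] [A' j'] /= AK jA AK' jA' sep sep' EA.
  subst A'; congr pair; apply/eqP/negPn/negP => jj'.
  have h1 := sep'.2 _ jA jj'; have h2 := sep.2 j' jA'.
  rewrite eq_sym in jj'; have := lt_trans h1 (h2 jj').
  by rewrite ltxx.
- exact: mS.
apply: le_measure; rewrite ?inE//.
- by apply: fin_bigcup_measurable => // p; exact: mS.
- exact: measurable_outage.
- move=> w [p /inS + [sep le]]; rewrite !inE => /andP[/eqP AK jA].
  by rewrite /outage /= (strict_separates_unique _ _ _ _ _ jA sep AK (topKK w)).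
Qed.

End outage_events.

(** * Rate threshold, reference density and assembly *)

Lemma log2_le {R : realType} (s rate : R) : 0 < rate ->
  (log2 (1 + s) <= rate) = (s <= 2 `^ rate - 1).
Proof.
move=> r0; have ln2 : 0 < ln (2 : R) by rewrite ln_gt0// ltr1n.
rewrite /log2 ler_pdivrMr// lerBrDl.
(* For a nonpositive argument [ln] is [0] by convention, and both inequalities hold. *)
have [s0|s0] := leP (1 + s) 0.
  by rewrite ln0// mulr_ge0 ?(ltW r0) ?(ltW ln2)// (le_trans s0) ?powR_ge0.
by rewrite -ler_expR lnK// /powR pnatr_eq0.
Qed.

Lemma ref_density_ge0 {R : realType} (phi x : R) : 0 < phi -> 0 <= ref_density phi x.
Proof.
move=> phi0; rewrite /ref_density /patch; case: ifP => // _.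
by rewrite mulr_ge0 ?expR_ge0// divr_ge0// ltW.
Qed.

Lemma measurable_ref_density {R : realType} (phi : R) :
  measurable_fun setT (ref_density phi).
Proof.
apply/(measurable_restrictT _ (measurable_itv _)); apply: measurable_funTS.
apply: measurable_funM => //; apply: measurableT_comp => //.
by apply: measurable_funM => //; exact: measurable_funN.
Qed.

Theorem mainTheorem1 (R : realType) (M K : nat)
    (W rate PS alpha sigma2 : R)
    (d : measure_display) (Omega : measurableType d) (P : probability Omega R)
    (gamma0 : {RV P >-> R}) (gamma : 'I_M -> {RV P >-> R})
    (KK : Omega -> {set 'I_M}) :
  (1 <= K)%N -> (K <= M - 1)%N ->
  0 < W -> 0 < rate -> 0 < PS -> 0 < alpha -> 0 < sigma2 ->
  let T := (M - K - 1)%N in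
  let mu := correlation_factor W in
  let phi := PS * alpha / sigma2 in
  let omega := (phi * (1 - mu))^-1 in
  let z := 2 `^ rate - 1 in
  has_density gamma0 (ref_density phi) ->
  cond_iid_density gamma0 gamma (port_density omega mu) ->
  (forall w, top_indices K (fun m => gamma m w) (KK w)) ->
  (P [set w | (log2 (1 + \sum_(m in KK w) gamma m w) <= rate)%R] =
   \int[lebesgue_measure]_(x0 in `[0%R, +oo[)
     \int[lebesgue_measure]_(v in `[0%R, (z / K%:R)%R])
       ((('C(M, K))%:R * (T + 1)%N%:R)%:E * Phi omega mu K z v x0
        * (Psi omega mu T v x0)%:E * (port_density omega mu x0 v)%:E
        * (ref_density phi x0)%:E))%E.
Proof.
move=> K1 KM W0 rate0 PS0 alpha0 sigma0 T.
(* Writing [M] as [(K + T).+1] removes the truncated subtractions and matches the layout of one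
   separating, [K] upper and [T] lower ports. *)
have hM : M = (K + T).+1 by rewrite /T; lia.
move: T hM => T hM; subst M.
move=> mu phi omega z X0f0 Xf topKK.
have phi0 : 0 < phi by rewrite divr_gt0// mulr_gt0.
have mu0 : 0 <= mu by rewrite mulr_ge0// sqrtr_ge0.
have mu1 : mu < 1 by exact: correlation_lt1 phi0 Xf.
have omega0 : 0 < omega by rewrite invr_gt0 mulr_gt0// subr_gt0.
have f0_ge0 x := ref_density_ge0 phi x phi0.
have f0_lt0 x : x < 0 -> ref_density phi x = 0.
  by move=> x0; rewrite /ref_density /patch mem_setE in_itv/= leNgt x0.
have mf0 := measurable_ref_density phi.
have f_ge0 := port_density_ge0 omega mu omega0.
have mf := measurable_port_density omega mu.
have c0 : 0 < ('C((K + T).+1, K))%:R * (T + 1)%N%:R :> R.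
  by rewrite mulr_gt0 ?ltr0n ?bin_gt0 ?addn1// ltnW// ltnS leq_addr.
under eq_set do rewrite log2_le//.
set I := (RHS).
(* The common probability of a single event: the claimed integral divided by the number of
   events. *)
pose q := ((('C((K + T).+1, K))%:R * (T + 1)%N%:R)^-1%:E * I)%E.
have qE s : tuple_density (K + T).+2
    (joint_density (K + T).+1 (ref_density phi) (port_density omega mu))
    (top_event s K T z) = q.
  rewrite /q /I -(tuple_density_top_event omega mu (ref_density phi) omega0 mu0 f0_ge0
    f0_lt0 mf0 s K T z _ K1 (ltW c0)).
  by rewrite muleA -EFinM mulVf ?mul1e// gt_eqF.
rewrite (prob_outage P K T gamma0 gamma z _ _ f0_ge0 mf0 f_ge0 mf X0f0 Xf KK topKK q qE).
have -> : ('C((K + T).+1, K) * T.+1)%:R = ('C((K + T).+1, K))%:R * (T + 1)%N%:R :> R.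
  by rewrite natrM addn1.
by rewrite /q muleA -EFinM mulfV ?mul1e// gt_eqF.
Qed.
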